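(* Let $\mathcal{M}$ be a regular structure with infinite universe $M$, and let $P_{\omega_1\text{-cat}}\subseteq B(\mathcal{M})$ be the family of infinite structures in $B(\mathcal{M})$ with countable signature whose complete theory is $\omega_1$-categorical. Then: $P_{\omega_1\text{-cat}}$ contains the least element of $\mathcal{B}(\mathcal{M})$; $P_{\omega_1\text{-cat}}$ is closed under permutations; it can fail under restrictions and expansions (there are members of $P_{\omega_1\text{-cat}}$ having a restriction in $B(\mathcal{M})$ not in $P_{\omega_1\text{-cat}}$, and members having an expansion in $B(\mathcal{M})$ not in $P_{\omega_1\text{-cat}}$); there is an infinite chain $\mathcal{N}_0<\mathcal{N}_1<\cdots$ of successive expansions in $B(\mathcal{M})$ whose members alternate between belonging and not belonging to $P_{\omega_1\text{-cat}}$; and there are structures $\mathcal{N}\in B(\mathcal{M})$ with finite signature such that $\triangledown_\mathcal{N}\cap P_{\omega_1\text{-cat}}=\emptyset$.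
   Context: A structure is regular if it is relational and no two distinct signature symbols have the same interpretation. For a regular $\mathcal{M}$ with universe $M$, $\overline{\mathcal{M}}$ is a maximal regular expansion of $\mathcal{M}$ on $M$ (every finitary relation on $M$ named by exactly one symbol), $B(\mathcal{M})$ is the set of restrictions of $\overline{\mathcal{M}}$ to subsignatures (universe $M$), and $\mathcal{B}(\mathcal{M})$ is the Boolean algebra on it given by union/intersection of signatures, with least element the structure with empty signature and order $\mathcal{N}_1\le\mathcal{N}_2$ iff $\mathcal{N}_2$ expands $\mathcal{N}_1$; $\triangledown_\mathcal{N}=\{\mathcal{K}\in B(\mathcal{M}):\mathcal{N}\le\mathcal{K}\}$. A theory is $\omega_1$-categorical if it has, up to isomorphism, exactly one model of cardinality $\omega_1$. For a permutation $f$ of $M$ and $\mathcal{N}\in B(\mathcal{M})$, $f(\mathcal{N})$ is the structure in $B(\mathcal{M})$ whose signature relations are the images $f(Q)$ of those of $\mathcal{N}$; a set $P$ is closed under permutations if $f(\mathcal{N})\in P$ for all $f$ and all $\mathcal{N}\in P$. *)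

(* Defs.v *)
From HB Require Import structures.
From mathcomp Require Import all_boot all_order.
From mathcomp Require Import boolp classical_sets functions cardinality.

Set Implicit Arguments.
Unset Strict Implicit.
Unset Printing Implicit Defensive.

Local Open Scope classical_set_scope.
Local Open Scope card_scope.

Record signature := Signature { symb :> Type; arity : symb -> nat }.

(* A structure with universe U in the relational signature L. *)
Definition structure_on (L : signature) (U : Type) : Type :=
  forall s : L, set ((arity s).-tuple U).

(* First-order formulas with equality; variables are named by natural numbers.
   The other connectives and the existential quantifier are definable, the
   semantics below being classical. *)
Inductive formula (L : signature) : Type :=
| FBot
| FEq (x y : nat)
| FAtom (s : L) (t : (arity s).-tuple nat)
| FImp (p q : formula L)
| FAll (x : nat) (p : formula L).

Fixpoint free_in (L : signature) (x : nat) (p : formula L) : bool :=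
  match p with
  | FBot => false
  | FEq y z => (x == y) || (x == z)
  | FAtom s t => x \in val t
  | FImp p q => free_in x p || free_in x q
  | FAll y p => (x != y) && free_in x p
  end.

Definition sentence (L : signature) (p : formula L) : Prop :=
  forall x, ~~ free_in x p.

Fixpoint sat (L : signature) (U : Type) (A : structure_on L U)
    (v : nat -> U) (p : formula L) : Prop :=
  match p with
  | FBot => False
  | FEq x y => v x = v y
  | FAtom s t => A s (map_tuple v t)
  | FImp p q => sat A v p -> sat A v q
  | FAll x p => forall a : U, sat A [eta v with x |-> a] p
  end.

(* For a sentence the valuation is irrelevant as soon as U is nonempty, and
   only infinite universes occur below. *)
Definition holds (L : signature) (U : Type) (A : structure_on L U)
    (p : formula L) : Prop := forall v : nat -> U, sat A v p.

Definition complete_theory (L : signature) (U : Type) (A : structure_on L U) :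
  set (formula L) := [set p | sentence p /\ holds A p].

Definition model_of (L : signature) (T : set (formula L)) (U : Type)
    (A : structure_on L U) : Prop := forall p, T p -> holds A p.

Definition isomorphic (L : signature) (U V : Type) (A : structure_on L U)
    (B : structure_on L V) : Prop :=
  exists f : U -> V, bijective f /\
    forall (s : L) (t : (arity s).-tuple U), A s t <-> B s (map_tuple f t).

(* omega_1 is the least uncountable cardinal. *)
Definition has_card_omega1 (X : Type) : Prop :=
  ~ countable [set: X] /\
  forall Y : Type, ~ countable [set: Y] -> [set: X] #<= [set: Y].

Definition omega1_categorical (L : signature) (T : set (formula L)) : Prop :=
  exists (X : Type) (A : structure_on L X),
    [/\ has_card_omega1 X, model_of T A &
        forall (Y : Type) (B : structure_on L Y),
          has_card_omega1 Y -> model_of T B -> isomorphic A B].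

(* Finitary relations on U; the arity is part of the relation, so that empty
   relations of different arities are different. *)
Definition finrel (U : Type) : Type := {n : nat & set (n.-tuple U)}.

Definition interp (L : signature) (U : Type) (A : structure_on L U) (s : L) :
  finrel U := existT (fun n => set (n.-tuple U)) (arity s) (A s).

Definition regular (L : signature) (U : Type) (A : structure_on L U) : Prop :=
  injective (interp A).

(* A' is an expansion of A; inclusion of signatures is an injection of symbols
   that respects arities and interpretations. *)
Definition expansion (L L' : signature) (U : Type) (A : structure_on L U)
    (A' : structure_on L' U) : Prop :=
  exists e : L -> L', injective e /\ forall s, interp A' (e s) = interp A s.

Definition maximal_regular_expansion (L L' : signature) (U : Type)
    (A : structure_on L U) (A' : structure_on L' U) : Prop :=
  [/\ regular A', expansion A A' &
      forall r : finrel U, exists! s : L', interp A' s = r].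

Lemma maximal_regular_expansion_exists (L : signature) (U : Type)
    (A : structure_on L U) : regular A ->
  exists (L' : signature) (A' : structure_on L' U),
    maximal_regular_expansion A A'.
Proof.
move=> regA; pose L' := Signature (fun r : finrel U => projT1 r).
pose A' : structure_on L' U := fun r => projT2 r.
have A'E r : interp A' r = r by case: r.
exists L', A'; split; first by move=> r1 r2; rewrite !A'E.
- by exists (interp A); split => // s; rewrite A'E.
- by move=> r; exists r; split=> [|r']; rewrite A'E.
Qed.

Definition subsignature (L : signature) (N : set L) : signature :=
  Signature (fun s : set_type N => arity (val s)).

Definition restriction (L : signature) (U : Type) (A : structure_on L U)
    (N : set L) : structure_on (subsignature N) U :=
  fun s => A (val s).

Arguments restriction {L U} A N s.

(* For A maximal regular, the Boolean algebra of the restrictions of A is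
   encoded as [set L]: N : set L stands for [restriction A N], union and
   intersection of signatures are those of [set L], the least element is
   [set0], and the order is inclusion, as justified by the next lemma. *)
Lemma subset_expansion (L : signature) (U : Type) (A : structure_on L U)
    (N1 N2 : set L) : regular A ->
  N1 `<=` N2 <-> expansion (restriction A N1) (restriction A N2).
Proof.
move=> regA; split=> [sub|[e [_ eE]] s N1s].
- have sub' (s : subsignature N1) : val s \in N2.
    by apply/mem_set/sub/set_mem/valP.
  exists (fun s => exist _ (val s) (sub' s)); split=> // s t [].
  exact: val_inj.
- set s1 : subsignature N1 := exist _ s (mem_set N1s).
  have es : val (e s1) = s by exact: (regA _ _ (eE s1)).
  by rewrite -es; apply/set_mem/valP.
Qed.

Definition up_set (L : signature) (N : set L) : set (set L) :=
  [set K | N `<=` K].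

Definition rel_image (U : Type) (f : U -> U) (r : finrel U) : finrel U :=
  existT (fun n => set (n.-tuple U)) (projT1 r) (map_tuple f @` projT2 r).

(* When A is maximal regular, every image relation is named by a symbol. *)
Definition perm_image (L : signature) (U : Type) (A : structure_on L U)
    (f : U -> U) (N : set L) : set L :=
  [set s' | exists2 s, N s & interp A s' = rel_image f (interp A s)].

Definition closed_under_permutations (L : signature) (U : Type)
    (A : structure_on L U) (P : set (set L)) : Prop :=
  forall f : U -> U, bijective f -> forall N, P N -> P (perm_image A f N).

Definition P_omega1_cat (L : signature) (U : Type) (A : structure_on L U) :
  set (set L) :=
  [set N | [/\ infinite_set [set: U], countable N &
               omega1_categorical (complete_theory (restriction A N))]].

(* Main.v *)
Require Import Defs.
From HB Require Import structures.
From mathcomp Require Import all_boot all_order.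
From mathcomp Require Import boolp classical_sets functions cardinality.
From mathcomp Require Import wochoice filter.
From Stdlib Require List.

Set Implicit Arguments.
Unset Strict Implicit.
Unset Printing Implicit Defensive.

Local Open Scope classical_set_scope.
Local Open Scope card_scope.

(** An arbitrary infinite [U] is in bijection with [I * J], where [J] is the set
    of finitely supported functions [nat -> bool].  Let [P_i] be the predicate
    saying that bit [i] is on, and let [E_j] relate two points with the same
    [I]-component and the same bits from [j] on.  With [P_i] for [i < k] and [E_j] for [j <= k],
    every [E_k]-class is a copy of the finite cube [2^k], so a model is
    determined by its number of classes and the theory is omega_1-categorical.
    Adding [P_k] splits the classes into two infinite sets whose cardinalities
    are independent of each other, which destroys categoricity; adding then
    [E_(k+1)] pairs the two sets and restores it.  This gives the alternating
    chain, and its first three members show that restrictions and expansions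
    can both leave the family.

    For the last claim, name an order of type omega on a countable subset of
    [U].  In any countable expansion, compactness yields generators [c_i],
    indexed by a given well-order, such that [c_i] lies above the values of all
    Skolem terms in the generators of smaller index.  In the Skolem hull, the
    order then has the cofinality of the index set; the index sets omega_1 and
    omega_1 + omega give two non-isomorphic models of cardinality omega_1. *)

(** * Cardinality *)

Lemma card_leTP (X Y : Type) :
  [set: X] #<= [set: Y] <-> exists f : X -> Y, injective f.
Proof.
split=> [/card_leP[f]|[f f_inj]]; last first.
  suff /injfunPex[g] : exists2 g, set_fun [set: X] [set: Y] g &
      set_inj [set: X] g by exact: inj_card_le.
  by exists f => // x y _ _; exact: f_inj.
have xT (x : X) : x \in [set: X] by rewrite in_setT.
exists (fun x => val (f (exist _ x (xT x)))) => x y /val_inj.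
by move/(@inj _ _ _ f) => /(_ (mem_set I) (mem_set I)) [].
Qed.

Lemma countableTP (X : Type) :
  countable [set: X] <-> exists f : X -> nat, injective f.
Proof. exact: card_leTP. Qed.

Lemma countable_cover (X Y : Type) (f : X -> Y) (A : set X) (B : set Y) :
  countable A -> (forall y, B y -> exists2 x, A x & f x = y) -> countable B.
Proof.
move=> cA AB; apply: sub_countable (_ : countable (f @` A)).
  by apply: subset_card_le => y /AB.
exact: sub_countable (card_image_le f A) cA.
Qed.

Lemma countable_subset (X : Type) (A B : set X) :
  A `<=` B -> countable B -> countable A.
Proof. by move=> AB; apply: sub_countable; exact: subset_card_le. Qed.

Lemma countable_preimage (X Y : Type) (f : X -> Y) (A : set Y) :
  injective f -> countable A -> countable [set x | A (f x)].
Proof.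
move=> f_inj /countable_injP[g g_inj]; apply/countable_injP.
exists (g \o f) => x y /set_mem Ax /set_mem Ay /g_inj.
by rewrite !in_setE => /(_ Ax Ay)/f_inj.
Qed.

Lemma infiniteTP (X : Type) :
  infinite_set [set: X] <-> exists f : nat -> X, injective f.
Proof. by rewrite infiniteP; exact: card_leTP. Qed.

Lemma uncountable_infinite (X : Type) :
  ~ countable [set: X] -> infinite_set [set: X].
Proof. by move=> cX /finite_set_countable. Qed.

Lemma uncountable_inh (X : Type) : ~ countable [set: X] -> exists x : X, True.
Proof.
move=> ucX; apply: contrapT => nX; apply: ucX; apply/countableTP.
by exists (fun _ => 0) => x; case: nX; exists x.
Qed.

(** Well-orders of type omega_1, described without ordinals: every proper initial segment is
    countable, the whole is not. *)
Record omega1_order (X : Type) (lt : X -> X -> Prop) : Prop := Omega1Order {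
  omega1_wf : well_founded lt;
  omega1_trans : forall x y z, lt x y -> lt y z -> lt x z;
  omega1_total : forall x y, [\/ lt x y, x = y | lt y x];
  omega1_init : forall x, countable [set y | lt y x];
  omega1_uncountable : ~ countable [set: X] }.

Lemma wf_preimage (X Y : Type) (lt : Y -> Y -> Prop) (f : X -> Y) :
  well_founded lt -> well_founded (fun x y => lt (f x) (f y)).
Proof.
move=> wf x; move: {2}(f x) (erefl (f x)) => y; move: x.
elim/(well_founded_ind wf): y => y IH x fx; constructor => z; rewrite fx.
by move=> h; exact: (IH (f z)).
Qed.

(* A transfinite greedy choice: each point is sent outside the image of its
   initial segment, which is countable. *)
Lemma has_card_omega1_wf (X : Type) (lt : X -> X -> Prop) :
  well_founded lt -> (forall x y, [\/ lt x y, x = y | lt y x]) ->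
  (forall x, countable [set y | lt y x]) -> ~ countable [set: X] ->
  has_card_omega1 X.
Proof.
move=> wf tot init unc; split=> //; elim/Pchoice => Y uncY; apply/card_leTP.
have [y0 _] := uncountable_inh uncY.
pose F x (rec : forall x', lt x' x -> Y) : Y :=
  xget y0 [set y | forall x' (h : lt x' x), rec x' h <> y].
pose f := Fix wf _ F.
have fE x : f x = xget y0 [set y | forall x', lt x' x -> f x' <> y].
  rewrite /f Fix_eq // => {}x g h gh; congr F.
  by apply: functional_extensionality_dep => z;
     apply: functional_extensionality_dep => hz; exact: gh.
have fP x x' : lt x' x -> f x' <> f x.
  rewrite [f x]fE; case: xgetP => [y _|none]; first exact.
  exfalso; apply: uncY; apply: (countable_cover (init x) (f := f)) => y _.
  by apply: contrapT => ny; apply: (none y) => x'' h ey; apply: ny; exists x''.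
by exists f => x y fxy; case: (tot x y) => // /fP; rewrite fxy.
Qed.

Lemma omega1_has_card (X : Type) (lt : X -> X -> Prop) :
  omega1_order lt -> has_card_omega1 X.
Proof. by case=> wf _ tot init unc; exact: (has_card_omega1_wf wf). Qed.

Lemma not_countable_powerset_nat : ~ countable [set: set nat].
Proof.
move=> /countableTP[f f_inj].
pose D : set nat := [set n | exists2 A, f A = n & ~ A n].
have nD : ~ D (f D) by move=> DD; case: (DD) => A /f_inj -> /(_ DD).
by apply: (nD); exists D.
Qed.

(** Well-order the uncountable powerset of [nat] and keep the points that have only countably many
    predecessors. *)
Lemma omega1_order_exists :
  exists (X : Type) (lt : X -> X -> Prop), omega1_order lt.
Proof.
pose W : eqType := {classic (set nat)}.
have uncW : ~ countable [set: W] := not_countable_powerset_nat.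
have [R woR] := well_ordering_principle W.
have woC : wo_chain R (predT : {pred W}) by move=> A _; exact: woR.
have Rtot x y : R x y \/ R y x by apply/orP; exact: (wo_chainW woC).
have Ranti x y : R x y -> R y x -> x = y.
  by move=> xy yx; apply: (wo_chain_antisymmetric woC) => //; rewrite xy.
have Rmin (P : set W) : P !=set0 -> exists2 x, P x & forall y, P y -> R x y.
  case=> x Px; have [|z [[zP zmin] _]] := woR (fun y => `[< P y >]).
    by exists x; apply/asboolP.
  by exists z => [|y Py]; [exact/asboolP|apply: zmin; exact/asboolP].
have Rtrans x y z : R x y -> R y z -> R x z.
  move=> xy yz; have [|m] := Rmin [set w | w = x \/ w = y \/ w = z].
    by exists x; left.
  case=> [->|[->|->]] mm; first by apply: mm; right; right.
    by rewrite (Ranti x y) //; apply: mm; left.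
  by rewrite -(Ranti y z) //; apply: mm; right; left.
pose lt x y := R x y /\ x <> y.
have lt_trans x y z : lt x y -> lt y z -> lt x z.
  move=> [xy nxy] [yz nyz]; split; first exact: Rtrans yz.
  by move=> xz; apply: nxy; apply: Ranti => //; rewrite xz.
have wf : well_founded lt.
  move=> x; apply: contrapT => nx.
  have [|m nm mmin] := Rmin [set y | ~ Acc lt y]; first by exists x.
  apply: nm; constructor => y [ym nym]; apply: contrapT => /mmin my.
  by apply: nym; exact: Ranti.
pose S : set W := [set y | countable [set z | lt z y]].
pose X := {y : W | S y}; pose ltX (x y : X) := lt (sval x) (sval y).
have svalI : injective (sval : X -> W).
  by move=> [x ?] [y ?] /=; exact: eq_exist.
exists X, ltX; split.
- exact: (@wf_preimage X W lt sval).
- by move=> x y z; exact: lt_trans.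
- move=> x y; have [xy|nxy] := pselect (x = y); first by constructor 2.
  by have [?|?] := Rtot (sval x) (sval y); [constructor 1|constructor 3];
     split=> // /svalI // /esym.
- by move=> [x Sx]; exact: (countable_preimage svalI Sx).
- move=> cX; have cS : countable S.
    by apply: (countable_cover cX (f := sval)) => y Sy; exists (exist _ y Sy).
  (* If [S] were countable, the least point outside it would have all its predecessors in [S], hence
     countably many, and would itself belong to [S]. *)
  have [|w nSw wmin] := Rmin (~` S).
    apply: contrapT => nS; apply: uncW; apply: countable_subset cS => y _.
    by apply: contrapT => nSy; apply: nS; exists y.
  apply: nSw; apply: countable_subset cS => z [zw nzw].
  by apply: contrapT => /wmin wz; apply: nzw; exact: Ranti.
Qed.

Lemma has_card_omega1_bij (X Y : Type) :
  has_card_omega1 X -> has_card_omega1 Y -> exists f : X -> Y, bijective f.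
Proof.
elim/Ppointed: Y => Y cX cY.
  by case: (cY) => + _; rewrite emptyE => /(_ (countable0 _)).
move: cX cY => [ucX leX] [ucY leY].
have := Cantor_Bernstein (leX _ ucY) (leY _ ucX).
move=> /card_set_bijP[f [_ finj fsurj]]; exists f.
have fS y : exists x, f x = y by have [x _ <-] := fsurj y I; exists x.
exists (fun y => projT1 (cid (fS y))) => [x|y]; case: cid => //= x' fx'.
by apply: finj; rewrite ?in_setT.
Qed.

Lemma has_card_omega1_order (X : Type) :
  has_card_omega1 X -> exists lt : X -> X -> Prop, omega1_order lt.
Proof.
move=> cX; have [W [lt ltW]] := omega1_order_exists.
have [f [g fK gK]] := has_card_omega1_bij cX (omega1_has_card ltW).
have f_inj := can_inj fK.
exists (fun x y => lt (f x) (f y)); case: (ltW) => wf tr tot init unc; split.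
- exact: wf_preimage.
- by move=> x y z; exact: tr.
- move=> x y; case: (tot (f x) (f y)) => [|/f_inj|]; first by constructor 1.
    by constructor 2.
  by constructor 3.
- by move=> x; exact: (countable_preimage f_inj (init (f x))).
- by case: cX.
Qed.

Lemma has_card_omega1_le (X Y : Type) (f : X -> Y) : injective f ->
  ~ countable [set: X] -> has_card_omega1 Y -> has_card_omega1 X.
Proof.
move=> f_inj ucX [ucY leY]; split=> // Z /leY; apply: card_le_trans.
by apply/card_leTP; exists f.
Qed.

Lemma countable_closed_init (X : Type) (lt : X -> X -> Prop) (x : X) :
  countable [set y | lt y x] -> countable [set y | lt y x \/ y = x].
Proof.
move=> init; rewrite (_ : mkset _ = [set y | lt y x] `|` [set x]) //.
by rewrite -bigcup2E; apply: bigcup_countable => // -[|[|i]] _ //=.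
Qed.

(* The lexicographic order by rank, then by an enumeration of the fibre. *)
Lemma has_card_omega1_fibers (X T : Type) (rk : T -> X) :
  has_card_omega1 X -> (forall x, countable [set t | rk t = x]) ->
  ~ countable [set: T] -> has_card_omega1 T.
Proof.
move=> /has_card_omega1_order[lt [wf tr tot init _]] fib ucT.
have /choice[e e_inj] : forall x, exists e : T -> nat,
    {in [set t | rk t = x] &, injective e}.
  by move=> x; exact/countable_injP/fib.
pose ltT t u := lt (rk t) (rk u) \/
                (rk t = rk u /\ (e (rk t) t < e (rk u) u)%N).
apply: (has_card_omega1_wf (lt := ltT) _ _ _ ucT).
- move=> t; move: {2}(rk t) (erefl (rk t)) => x; move: t.
  elim/(well_founded_ind wf): x => x IH t.
  move: {2}(e (rk t) t) (erefl (e (rk t) t)) => n; move: t.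
  elim/ltn_ind: n => n IHn t tn tx.
  constructor=> u [h|[ut lt_e]]; first by apply: (IH (rk u)); rewrite -?tx.
  by apply: (IHn (e (rk u) u) _ u erefl); rewrite -?tn // ut.
- move=> t u; case: (tot (rk t) (rk u)) => [?|tu|?].
  + by constructor 1; left.
  + case: (ltngtP (e (rk t) t) (e (rk u) u)) => eq_e.
    * by constructor 1; right.
    * by constructor 3; right.
    * constructor 2; apply: (e_inj (rk u)); rewrite ?in_setE //.
      by rewrite -{1}tu.
  + by constructor 3; left.
- move=> t; apply: (@countable_subset _ _
    (\bigcup_(x in [set x | lt x (rk t) \/ x = rk t]) [set u | rk u = x])).
    move=> u [h|[h _]]; exists (rk u) => //=; by [left|right].
  by apply: bigcup_countable => //; exact: countable_closed_init.
Qed.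

Lemma has_card_omega1_add_nat (X : Type) :
  has_card_omega1 X -> has_card_omega1 (X + nat).
Proof.
move=> cX; have [ucX _] := cX.
have [x0 _] := uncountable_inh ucX.
(* All natural numbers join the fibre of [x0], so each fibre has at most one point besides them. *)
apply: (has_card_omega1_fibers cX
  (rk := fun t => if t is inl x then x else x0)).
  move=> x; apply: (@countable_cover (option nat) _
    (fun o => if o is Some n then inr n else inl x) setT) => //.
  by case=> [y|n] /= h; [exists None; rewrite // h|exists (Some n)].
move=> /countableTP[f f_inj]; apply: ucX; apply/countableTP.
by exists (f \o inl) => x y /f_inj [].
Qed.

(** * Formulas and theories *)

Lemma map_tuple_comp (n : nat) (U V W : Type) (f : U -> V) (g : V -> W)
    (t : n.-tuple U) : map_tuple g (map_tuple f t) = map_tuple (g \o f) t.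
Proof. by apply: val_inj; rewrite /= map_comp. Qed.

Lemma map_tuple_tcast (m n : nat) (U V : Type) (f : U -> V) (mn : m = n)
    (t : m.-tuple U) : map_tuple f (tcast mn t) = tcast mn (map_tuple f t).
Proof. by case: n / mn. Qed.

Lemma withE (U V : Type) (f : U -> V) (v : nat -> U) (x : nat) (a : U) :
  f \o [eta v with x |-> a] = [eta (f \o v) with x |-> f a].
Proof. by apply/funext => y /=; case: eqP. Qed.

Lemma with_id (U : Type) (v : nat -> U) (x : nat) :
  [eta v with x |-> v x] = v :> (nat -> U).
Proof. by apply/funext => y /=; case: eqP => // ->. Qed.

Lemma sat_agree (L : signature) (U : Type) (A : structure_on L U)
    (p : formula L) (v w : nat -> U) :
  (forall x, free_in x p -> v x = w x) -> sat A v p <-> sat A w p.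
Proof.
elim: p v w => [|x y|s t|p IHp q IHq|x p IHp] v w /= vw //.
- by rewrite (vw x) ?(vw y) ?eqxx ?orbT.
- suff -> : map_tuple v t = map_tuple w t by [].
  by apply: val_inj => /=; apply/eq_in_map => x /vw.
- have IHp' := IHp v w (fun x h => vw x (introT orP (or_introl h))).
  have IHq' := IHq v w (fun x h => vw x (introT orP (or_intror h))).
  by rewrite IHp' IHq'.
- have IH a : sat A [eta v with x |-> a] p <-> sat A [eta w with x |-> a] p.
    apply: IHp => y yp /=.
    by case: eqP => // /eqP xy; rewrite vw // xy.
  by split=> h a; apply/IH.
Qed.

Lemma free_in_bound (L : signature) (p : formula L) :
  exists m, forall x, free_in x p -> x < m.
Proof.
elim: p => [|y z|s t|p [m mP] q [n nP]|y p [m mP]] /=.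
- by exists 0.
- exists (maxn y z).+1 => x /orP[] /eqP ->; by rewrite ltnS (leq_maxl, leq_maxr).
- exists (\max_(x <- val t) x).+1 => x xt.
  by rewrite ltnS (big_rem x) //= leq_maxl.
- exists (maxn m n) => x /orP[/mP|/nP] h; apply: leq_trans h _;
  by rewrite (leq_maxl, leq_maxr).
- by exists m => x /andP[_ /mP].
Qed.

Lemma holds_all (L : signature) (U : Type) (A : structure_on L U)
    (p : formula L) (x : nat) : holds A (FAll x p) <-> holds A p.
Proof.
split=> h v /=; last by move=> a; exact: h.
by have := h v (v x); rewrite with_id.
Qed.

Lemma universal_closure (L : signature) (p : formula L) :
  exists2 q, sentence q &
    forall (U : Type) (A : structure_on L U), holds A q <-> holds A p.
Proof.
have [m mP] := free_in_bound p.
exists (foldr (@FAll L) p (iota 0 m)); last first.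
  by move=> U A; elim: (iota 0 m) => //= x l IH; rewrite holds_all.
move=> x; apply/negP => h.
suff [xp] : free_in x p /\ x \notin iota 0 m by rewrite mem_iota /= (mP _ xp).
elim: (iota 0 m) h => //= y l IH /andP[xy /IH [xp xl]].
by rewrite inE negb_or xy.
Qed.

(** Theories contain sentences only; the universal closure makes open formulas transferable as
    well. *)
Lemma model_of_holds (L : signature) (U V : Type) (A : structure_on L U)
    (B : structure_on L V) (p : formula L) :
  model_of (complete_theory A) B -> holds A p -> holds B p.
Proof.
move=> AB Ap; have [q sq qp] := universal_closure p.
by apply/qp; apply: AB; split=> //; apply/qp.
Qed.

(* Only the variables in the list [S] are controlled by the relation [Z]. *)
Lemma back_and_forth (L : signature) (U V : Type) (A : structure_on L U)
    (B : structure_on L V) (Z : seq nat -> (nat -> U) -> (nat -> V) -> Prop) :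
  (forall S v w x y, Z S v w -> x \in S -> y \in S ->
     (v x = v y <-> w x = w y)) ->
  (forall S v w s (t : (arity s).-tuple nat), Z S v w -> {subset t <= S} ->
     (A s (map_tuple v t) <-> B s (map_tuple w t))) ->
  (forall S v w x a, Z S v w ->
     exists b, Z (x :: S) [eta v with x |-> a] [eta w with x |-> b]) ->
  (forall S v w x b, Z S v w ->
     exists a, Z (x :: S) [eta v with x |-> a] [eta w with x |-> b]) ->
  forall p S v w, Z S v w -> (forall x, free_in x p -> x \in S) ->
    (sat A v p <-> sat B w p).
Proof.
move=> Zeq Zatom forth back.
elim=> [|x y|s t|p IHp q IHq|x p IHp] S v w /= Zvw fS //.
- by apply: Zeq Zvw _ _; apply: fS; rewrite eqxx ?orbT.
- exact: Zatom Zvw _.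
- have -> : sat A v p <-> sat B w p.
    by apply: IHp Zvw _ => x xp; apply: fS; rewrite xp.
  have -> // : sat A v q <-> sat B w q.
  by apply: IHq Zvw _ => x xq; apply: fS; rewrite xq orbT.
- have fS' y : free_in y p -> y \in x :: S.
    by rewrite inE => yp; case: eqP => //= /eqP xy; rewrite fS // xy.
  split=> h a.
    by have [b Zab] := back S v w x a Zvw; exact/(IHp _ _ _ Zab).
  by have [b Zab] := forth S v w x a Zvw; exact/(IHp _ _ _ Zab).
Qed.

Lemma isomorphic_sat (L : signature) (U V : Type) (A : structure_on L U)
    (B : structure_on L V) (f : U -> V) (p : formula L) (v : nat -> U) :
  bijective f -> (forall s t, A s t <-> B s (map_tuple f t)) ->
  sat A v p <-> sat B (f \o v) p.
Proof.
move=> [g fK gK] AB; have [m mP] := free_in_bound p.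
(* The back-and-forth relation is the graph of [f], whatever the list of variables. *)
apply: (back_and_forth (Z := fun _ v w => w = f \o v) _ _ _ _ (S := iota 0 m)).
- by move=> _ {}v _ x y -> _ _ /=; split=> [->|/(can_inj fK)].
- by move=> _ {}v _ s t -> _; rewrite AB map_tuple_comp.
- by move=> _ {}v _ x a ->; exists (f a); rewrite withE.
- by move=> _ {}v _ x b ->; exists (g b); rewrite withE gK.
- by [].
- by move=> x /mP xm; rewrite mem_iota.
Qed.

Lemma isomorphic_holds (L : signature) (U V : Type) (A : structure_on L U)
    (B : structure_on L V) (f : U -> V) (p : formula L) :
  bijective f -> (forall s t, A s t <-> B s (map_tuple f t)) ->
  holds A p <-> holds B p.
Proof.
move=> bf AB; split=> h v; last exact/(isomorphic_sat _ _ bf AB).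
have [g fK gK] := bf; have := h (g \o v).
rewrite (isomorphic_sat _ _ bf AB); congr sat.
by apply/funext => x /=.
Qed.

Lemma isomorphic_sym (L : signature) (U V : Type) (A : structure_on L U)
    (B : structure_on L V) : isomorphic A B -> isomorphic B A.
Proof.
move=> [f [[g fK gK] AB]]; exists g; split; first by exists f.
move=> s t; rewrite AB map_tuple_comp.
suff -> : map_tuple (f \o g) t = t by [].
by apply: val_inj; rewrite /= (eq_map gK) map_id.
Qed.

Lemma isomorphic_trans (L : signature) (U V W : Type) (A : structure_on L U)
    (B : structure_on L V) (C : structure_on L W) :
  isomorphic A B -> isomorphic B C -> isomorphic A C.
Proof.
move=> [f [bf AB]] [g [bg BC]]; exists (g \o f); split; first exact: bij_comp.
by move=> s t; rewrite AB BC map_tuple_comp.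
Qed.

Lemma countable_formula (L : signature) :
  countable [set: L] -> countable [set: formula L].
Proof.
move=> /countableTP[e e_inj].
pose T := GenTree.tree nat.
pose leaf (n : nat) : T := GenTree.Leaf n.
pose code := fix code (p : formula L) : T := match p with
  | FBot => GenTree.Node 0 [::]
  | FEq x y => GenTree.Node 1 [:: leaf x; leaf y]
  | FAtom s t => GenTree.Node 2 (leaf (e s) :: map leaf (val t))
  | FImp p q => GenTree.Node 3 [:: code p; code q]
  | FAll x p => GenTree.Node 4 [:: leaf x; code p]
  end.
have leaf_inj : injective leaf by move=> m n [].
apply/countableTP; exists (pickle \o code) => p q /(pcan_inj pickleK).
elim: p q => [|x y|s t|p IHp q IHq|x p IHp] [|x' y'|s' t'|p' q'|x' p'] //=.
- by case=> -> ->.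
- case=> /e_inj ss'; case: s' / ss' t' => t' /(inj_map leaf_inj) tt'.
  by congr FAtom; exact: val_inj.
- by case=> /IHp -> /IHq ->.
- by case=> -> /IHp ->.
Qed.

(** * Renaming the symbols *)

Section Rename.
Variables (L L' : signature) (e : L' -> L).
Hypothesis ea : forall s, arity s = arity (e s).

Fixpoint rename (p : formula L') : formula L := match p with
  | FBot => FBot L
  | FEq x y => FEq L x y
  | FAtom s t => FAtom (tcast (ea s) t)
  | FImp p q => FImp (rename p) (rename q)
  | FAll x p => FAll x (rename p)
  end.

Definition pullback (Y : Type) (B : structure_on L Y) : structure_on L' Y :=
  fun s t => B (e s) (tcast (ea s) t).

Lemma sat_pullback (Y : Type) (B : structure_on L Y) p v :
  sat (pullback B) v p <-> sat B v (rename p).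
Proof.
elim: p v => [|x y|s t|p IHp q IHq|x p IHp] v //=.
- by rewrite /pullback map_tuple_tcast.
- by rewrite IHp IHq.
- by split=> h a; exact/IHp.
Qed.

Lemma holds_pullback (Y : Type) (B : structure_on L Y) p :
  holds (pullback B) p <-> holds B (rename p).
Proof. by split=> h v; exact/sat_pullback. Qed.

Lemma model_of_pullback (U U' Y : Type) (A : structure_on L U)
    (A' : structure_on L' U') (B : structure_on L Y) :
  isomorphic (pullback A) A' ->
  model_of (complete_theory A) B -> model_of (complete_theory A') (pullback B).
Proof.
move=> [f [bf AA']] AB p [_ pA']; apply/holds_pullback.
apply: model_of_holds AB _; apply/holds_pullback.
exact/(isomorphic_holds p bf AA').
Qed.

End Rename.

(** A model of the theory of [A'] pulls back along [e'] to a model of the theory of [A], where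
    categoricity applies. Pulling back again along [e] returns the original structure, because [e']
    undoes [e]. *)
Lemma omega1_categorical_rename (L L' : signature) (e : L' -> L) (e' : L -> L')
    (ea : forall s, arity s = arity (e s))
    (ea' : forall s, arity s = arity (e' s)) (U U' : Type)
    (A : structure_on L U) (A' : structure_on L' U') :
  cancel e e' ->
  isomorphic (pullback ea A) A' -> isomorphic (pullback ea' A') A ->
  omega1_categorical (complete_theory A) ->
  omega1_categorical (complete_theory A').
Proof.
move=> eK isoA isoA' [X [B [cX AB catB]]].
exists X, (pullback ea B); split=> //; first exact: model_of_pullback AB.
move=> Y B' cY A'B'.
have [f [bf fP]] := catB Y (pullback ea' B') cY (model_of_pullback isoA' A'B').
exists f; split=> // s t; rewrite /pullback fP /pullback map_tuple_tcast.
(* The two casts compose to one, which is the identity once [e' (e s)] is rewritten to [s]. *)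
move: (ea s) (ea' (e s)) => h h'; rewrite -tcast_trans; move: (etrans _ _).
by rewrite eK => h''; rewrite tcast_id.
Qed.

(** * Skolem hulls of well-ordered sequences *)

(* A term denotes a finite sequence of elements, and also the element at the
   head of that sequence; the arguments of a Skolem function are collected in
   a single sequence with [TCons]. *)
Inductive term (I : Type) : Type :=
| TGen (i : I)
| TNil
| TCons (t u : term I)
| TSkolem (n : nat) (t : term I).

Arguments TNil {I}.

Fixpoint gens_in (I : Type) (S : set I) (t : term I) : Prop :=
  match t with
  | TGen i => S i
  | TNil => True
  | TCons t u => gens_in S t /\ gens_in S u
  | TSkolem _ t => gens_in S t
  end.

Lemma gens_in_sub (I : Type) (S S' : set I) (t : term I) :
  S `<=` S' -> gens_in S t -> gens_in S' t.
Proof.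
by move=> SS'; elim: t => [i /SS'||t IHt u IHu [/IHt ? /IHu]|n t IHt] //=.
Qed.

Lemma countable_term (I : Type) (S : set I) :
  countable S -> countable [set t : term I | gens_in S t].
Proof.
move=> /countable_injP[g g_inj]; apply/countable_injP.
pose T := GenTree.tree nat.
pose code := fix code (t : term I) : T := match t with
  | TGen i => GenTree.Leaf (g i)
  | TNil => GenTree.Node 0 [::]
  | TCons t u => GenTree.Node 1 [:: code t; code u]
  | TSkolem n t => GenTree.Node n.+2 [:: code t]
  end.
exists (pickle \o code) => t u; rewrite !in_setE /= => St Su.
move/(pcan_inj pickleK).
elim: t u St Su => [i||t IHt t' IHt'|n t IHt] [i'||u u'|n' u] //=.
- by move=> Si Si' [] gi; congr TGen; apply: g_inj; rewrite ?in_setE.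
- by move=> [St St'] [Su Su'] [] /IHt -> // /IHt' ->.
- by move=> St Su [] -> /IHt ->.
Qed.

Section GensBound.
Variables (I : Type) (lt : I -> I -> Prop) (i0 : I).
Hypothesis lt_trans : forall x y z, lt x y -> lt y z -> lt x z.
Hypothesis lt_total : forall x y, [\/ lt x y, x = y | lt y x].

Lemma gens_bounded (t : term I) :
  exists i, gens_in [set i' | lt i' i \/ i' = i] t.
Proof.
pose le i : set I := [set i' | lt i' i \/ i' = i].
have ub i j : exists k, le i `<=` le k /\ le j `<=` le k.
  case: (lt_total i j) => [ij|->|ji]; [exists j|exists j|exists i]; split=> //= k.
  - by case=> [h|->]; left => //; exact: lt_trans ij.
  - by case=> [h|->]; left => //; exact: lt_trans ji.
elim: t => [i||t [i it] u [j ju]|n t] //=.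
- by exists i; right.
have [k [ik jk]] := ub i j; exists k; split;
by [exact: gens_in_sub it|exact: gens_in_sub ju].
Qed.

End GensBound.

(** Rank a term by a bound on its generators. The terms of a given rank use countably many
    generators, so the fibres are countable. *)
Lemma has_card_omega1_term (I : Type) :
  has_card_omega1 I -> has_card_omega1 (term I).
Proof.
move=> cI; have [i0 _] := uncountable_inh (proj1 cI).
have [lt [wf tr tot init unc]] := has_card_omega1_order cI.
have /choice[rk rkP] := gens_bounded i0 tr tot.
apply: (has_card_omega1_fibers (rk := rk) cI).
  move=> i; apply: (@countable_subset _ _
    [set t | gens_in [set i' | lt i' i \/ i' = i] t]) => [t <- //|].
  by apply: countable_term; exact: countable_closed_init.
move=> /countableTP[f f_inj]; apply: unc; apply/countableTP.
by exists (f \o @TGen I) => x y /f_inj [].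
Qed.

(** Going through the underlying sequence avoids casting tuples along a proof of [arity s = 2]. *)
Definition binrel (L : signature) (M : Type) (B : structure_on L M) (s : L)
    (a b : M) : Prop :=
  exists2 t : (arity s).-tuple M, val t = [:: a; b] & B s t.

Section Hull.
Variables (L : signature) (U : Type) (A : structure_on L U) (q : nat -> U).
Variable dec : nat -> formula L * nat.
Hypothesis dec_surj : forall px, exists n, dec n = px.
Hypothesis q_inj : injective q.
Variables (I : Type) (lt : I -> I -> Prop) (i0 : I).
Hypothesis wf : well_founded lt.
Hypothesis lt_trans : forall x y z, lt x y -> lt y z -> lt x z.
Hypothesis lt_total : forall x y, [\/ lt x y, x = y | lt y x].
Hypothesis no_max : forall i, exists j, lt i j.

(* A counterexample to the [n]-th formula, if there is one. *)
Definition skolem (n : nat) (s : seq U) : U :=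
  match pselect (exists a,
    ~ sat A [eta nth (q 0) s with (dec n).2 |-> a] (dec n).1) with
  | left h => projT1 (cid h)
  | right _ => q 0
  end.

Lemma skolemP n s a :
  ~ sat A [eta nth (q 0) s with (dec n).2 |-> a] (dec n).1 ->
  ~ sat A [eta nth (q 0) s with (dec n).2 |-> skolem n s] (dec n).1.
Proof.
move=> na; rewrite /skolem; case: pselect => [h|]; last by case; exists a.
by case: cid.
Qed.

Fixpoint evals (g : I -> nat) (t : term I) : seq U :=
  match t with
  | TGen i => [:: q (g i)]
  | TNil => [::]
  | TCons t u => head (q 0) (evals g t) :: evals g u
  | TSkolem n t => [:: skolem n (evals g t)]
  end.

Definition eval g t := head (q 0) (evals g t).

Lemma evals_agree (S : set I) g h t :
  gens_in S t -> (forall i, S i -> g i = h i) -> evals g t = evals h t.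
Proof.
move=> St gh; elim: t St => [i|//|t IHt u IHu|n t IHt] /=.
- by move/gh ->.
- by case=> /IHt -> /IHu ->.
- by move/IHt ->.
Qed.

(** The default 0 off the range of [q] is harmless: generators only have to dominate those terms
    whose value is some [q n]. *)
Definition qindex (u : U) : nat :=
  match pselect (exists n, q n = u) with
  | left h => projT1 (cid h)
  | right _ => 0
  end.

Lemma qindexK n : qindex (q n) = n.
Proof.
rewrite /qindex; case: pselect => [h|]; last by case; exists n.
by case: cid => m /= /q_inj.
Qed.

(* The generator [i] is sent beyond the value of every term of the list [ts]
   that only involves generators smaller than [i]. *)
Definition greedy (ts : seq (term I)) : I -> nat :=
  Fix wf (fun _ => nat) (fun i rec =>
    (foldr (fun t => maxn (qindex (eval (fun j =>
       if pselect (lt j i) is left h then rec j h else 0) t))) 0 ts).+1).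

Definition below (i : I) (g : I -> nat) (j : I) : nat :=
  if pselect (lt j i) is left _ then g j else 0.

Lemma greedyE ts i : greedy ts i =
  (foldr (fun t => maxn (qindex (eval (below i (greedy ts)) t))) 0 ts).+1.
Proof.
rewrite {1}/greedy Fix_eq // => {}i g h gh.
suff -> : g = h by [].
by apply: functional_extensionality_dep => j;
   apply: functional_extensionality_dep => ji; exact: gh.
Qed.

(** The term sees only generators below [i], so truncating at [i] does not change its value, and the
    successor in the recursion exceeds the maximum over the list. *)
Lemma greedyP ts t i : List.In t ts -> gens_in [set j | lt j i] t ->
  qindex (eval (greedy ts) t) < greedy ts i.
Proof.
move=> tts ti; rewrite [greedy ts i]greedyE ltnS.
have -> : eval (greedy ts) t = eval (below i (greedy ts)) t.
  rewrite /eval (evals_agree (h := below i (greedy ts)) ti) // => j /= ji.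
  by rewrite /below; case: pselect.
elim: {1 4}ts tts => //= u us IH [->|/IH h]; first exact: leq_maxl.
exact: leq_trans h (leq_maxr _ _).
Qed.

(** Compactness takes the form of an ultrafilter on finite lists of terms. The placement [greedy ts]
    is correct for the terms in [ts], and by [W_in] each term occurs in almost every list. *)
Variable W : set_system (seq (term I)).
Context {WU : UltraFilter W}.
Hypothesis W_in : forall t, W [set ts | List.In t ts].

Let value (ts : seq (term I)) (t : term I) : U := eval (greedy ts) t.

Lemma ultra_and (S T : set (seq (term I))) : W S -> W T -> W (S `&` T).
Proof. exact: filterI. Qed.

Lemma ultra_sub (S T : set (seq (term I))) : S `<=` T -> W S -> W T.
Proof. by move=> ST; apply: filterS. Qed.

Lemma ultra_notE (S : set (seq (term I))) : W (~` S) <-> ~ W S.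
Proof.
split=> [nS S_|nS].
  by apply: (@filter_not_empty _ W _); apply: ultra_sub (ultra_and S_ nS) => x [].
by have [] := in_ultra_setVsetC S WU.
Qed.

Definition ueq t u := W [set ts | value ts t = value ts u].

Lemma ueq_class t u : ueq t u -> ueq t = ueq u.
Proof.
move=> tu; apply/funext => x; apply/propext; split=> h;
by apply: ultra_sub (ultra_and tu h) => ts /= [-> ->].
Qed.

Lemma ueq_refl t : ueq t t.
Proof. by apply: ultra_sub filterT => ts. Qed.

(** The submodel of an ultrapower of [A] formed by the Skolem terms, that is, terms modulo equality
    of values almost everywhere. *)
Definition hull : Type := {C : set (term I) | exists t, C = ueq t}.

Definition rep (C : hull) : term I := projT1 (cid (proj2_sig C)).

Definition cls (t : term I) : hull := exist _ (ueq t) (ex_intro _ t erefl).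

Lemma rep_class C : sval C = ueq (rep C).
Proof. by rewrite /rep; case: cid. Qed.

Lemma rep_cls t : ueq t (rep (cls t)).
Proof. by have := rep_class (cls t); rewrite /= => ->; exact: ueq_refl. Qed.

Lemma ueq_rep C D : ueq (rep C) (rep D) <-> C = D.
Proof.
split=> [h|->]; last exact: ueq_refl.
have : sval C = sval D by rewrite !rep_class; exact: ueq_class.
by case: C D {h} => [C ?] [D ?] /=; exact: eq_exist.
Qed.

Definition hvalue ts (C : hull) : U := value ts (rep C).

Lemma hvalue_cls t : W [set ts | hvalue ts (cls t) = value ts t].
Proof. by apply: ultra_sub (rep_cls t) => ts /= ->. Qed.

Definition hull_structure : structure_on L hull :=
  fun s t => W [set ts | A (map_tuple (hvalue ts) t)].

(** One term serves all lists [ts] at once: the Skolem function of the pair [(p, x)], applied to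
    representatives of the variables below a bound on the free variables of [p]. *)
Lemma skolem_term (v : nat -> hull) p x :
  exists t, forall ts a, ~ sat A [eta (hvalue ts \o v) with x |-> a] p ->
    ~ sat A [eta (hvalue ts \o v) with x |-> value ts t] p.
Proof.
have [n nP] := dec_surj (p, x); have [m mP] := free_in_bound p.
pose args := foldr (fun y => TCons (rep (v y))) TNil (iota 0 m).
exists (TSkolem n args) => ts a.
have argsE : evals (greedy ts) args = [seq hvalue ts (v y) | y <- iota 0 m].
  by rewrite /args; elim: (iota 0 m) => //= y l ->.
have agree b : sat A [eta (hvalue ts \o v) with x |-> b] p <->
    sat A [eta nth (q 0) (evals (greedy ts) args) with x |-> b] p.
  apply: sat_agree => y /mP ym /=; case: eqP => // _.
  by rewrite argsE (nth_map 0) ?size_iota // nth_iota.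
rewrite !agree => na; have := @skolemP n (evals (greedy ts) args) a.
by rewrite nP; exact.
Qed.

(** The theorem of Los for the hull. In the universal case, a failure for almost all lists is
    witnessed by the single element that [skolem_term] provides. *)
Lemma hull_sat p v :
  sat hull_structure v p <-> W [set ts | sat A (hvalue ts \o v) p].
Proof.
elim: p v => [|x y|s t|p IHp q' IHq|x p IHp] v.
- by split=> // h; exact: (@filter_not_empty _ W _).
- by rewrite /= -ueq_rep.
- rewrite /= /hull_structure.
  by under eq_set do rewrite map_tuple_comp.
- rewrite /= IHp IHq; split=> [h|h hp]; last first.
    by apply: ultra_sub (ultra_and h hp) => ts /= [hh /hh].
  have [/h|/ultra_notE] := pselect (W [set ts | sat A (hvalue ts \o v) p]).
    by apply: ultra_sub => ts /=.
  by apply: ultra_sub => ts /=.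
- split=> [h|h C]; last first.
    apply/IHp; apply: ultra_sub h => ts /= /(_ (hvalue ts C)).
    by rewrite withE.
  apply: contrapT => /ultra_notE nall.
  have [t tP] := skolem_term v p x.
  have /IHp pt := h (cls t).
  apply: (@filter_not_empty _ W _).
  apply: ultra_sub (ultra_and (hvalue_cls t) (ultra_and nall pt)) => ts /=.
  rewrite withE => -[-> [na pa]]; apply: na => a.
  by apply: contrapT => /tP.
Qed.

Lemma hull_model : model_of (complete_theory A) hull_structure.
Proof.
by move=> p [_ pA] v; apply/hull_sat; apply: ultra_sub filterT => ts _; exact: pA.
Qed.

Definition gen (i : I) : hull := cls (TGen i).

Lemma value_gen ts i : value ts (TGen i) = q (greedy ts i).
Proof. by []. Qed.

(** For [i] below [j], [greedyP] separates the two indices in every list that contains [TGen i]. *)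
Lemma gen_inj : injective gen.
Proof.
have gen_lt i j : lt i j -> gen i <> gen j.
  move=> ij /ueq_rep h; apply: (@filter_not_empty _ W _).
  have := ultra_and h (ultra_and (hvalue_cls (TGen i))
    (ultra_and (hvalue_cls (TGen j)) (W_in (TGen i)))).
  apply: ultra_sub => ts /= [ee [ei [ej i_ts]]].
  have := greedyP i_ts (ij : gens_in [set k | lt k j] (TGen i)).
  have : value ts (TGen i) = value ts (TGen j) by rewrite -ei -ej.
  by rewrite !value_gen /eval /= qindexK => /q_inj ->; rewrite ltnn.
by move=> i j ij; case: (lt_total i j) => // /gen_lt; rewrite ij.
Qed.

Lemma hull_card : has_card_omega1 I -> has_card_omega1 hull.
Proof.
move=> cI; apply: (has_card_omega1_le (f := rep)).
- by move=> C D h; apply/ueq_rep; rewrite h; exact: ueq_refl.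
- case: cI => ucI _ /countableTP[f f_inj]; apply: ucI; apply/countableTP.
  by exists (f \o gen) => i j /f_inj/gen_inj.
- exact: has_card_omega1_term.
Qed.

Section Order.
Variable s : L.
Hypothesis s2 : arity s = 2.
Hypothesis sP : forall t : (arity s).-tuple U,
  A t <-> exists m n, m < n /\ val t = [:: q m; q n].

Lemma hull_binrelE C D : binrel hull_structure s C D <->
  W [set ts | exists m n, [/\ m < n, hvalue ts C = q m & hvalue ts D = q n]].
Proof.
split=> [[t tE]|h].
  apply: ultra_sub => ts /sP [m [n [mn]]] /=; rewrite tE /= => -[h1 h2].
  by exists m, n.
exists (tcast (esym s2) [tuple C; D]); first by rewrite /= val_tcast.
apply: ultra_sub h => ts /= [m [n [mn h1 h2]]]; apply/sP; exists m, n.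
by rewrite map_tuple_tcast /= val_tcast /= h1 h2.
Qed.

Lemma hull_binrel_irrefl C : ~ binrel hull_structure s C C.
Proof.
move=> /hull_binrelE h; apply: (@filter_not_empty _ W _).
apply: ultra_sub h => ts /=.
by move=> [m [n [+ -> /q_inj mn]]]; rewrite mn ltnn.
Qed.

Lemma hull_binrel_trans C D E : binrel hull_structure s C D ->
  binrel hull_structure s D E -> binrel hull_structure s C E.
Proof.
move=> /hull_binrelE h1 /hull_binrelE h2; apply/hull_binrelE.
apply: ultra_sub (ultra_and h1 h2).
move=> ts /= [[m [n [mn -> ->]]] [n' [k [nk /q_inj nn' ->]]]]; exists m, k.
by split=> //; apply: ltn_trans mn _; rewrite nn'.
Qed.

Lemma hull_binrel_gen t i : gens_in [set j | lt j i] t ->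
  W [set ts | exists n, value ts t = q n] ->
  binrel hull_structure s (cls t) (gen i).
Proof.
move=> ti h; apply/hull_binrelE.
apply: ultra_sub (ultra_and h (ultra_and (W_in t)
  (ultra_and (hvalue_cls t) (hvalue_cls (TGen i))))).
move=> ts /= [[n tn] [in_ts [-> ->]]]; exists n, (greedy ts i); split=> //.
by have := greedyP in_ts ti; rewrite -/(value _ _) tn qindexK.
Qed.

(** Lying below something forces the value of [C] onto the sequence [q], as [hull_binrel_gen]
    requires. A representative of [C] uses generators up to some [i] only, and a generator beyond
    [i] exceeds it. *)
Lemma hull_binrel_cofinal C D :
  binrel hull_structure s C D -> exists i, binrel hull_structure s C (gen i).
Proof.
move=> /hull_binrelE h; have [i Ci] := gens_bounded i0 lt_trans lt_total (rep C).
have [j ij] := no_max i; exists j.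
have -> : C = cls (rep C) by apply/ueq_rep; exact: rep_cls.
apply: hull_binrel_gen.
  by apply: gens_in_sub Ci => k /= [ki|->] //; exact: lt_trans ij.
by apply: ultra_sub h => ts /= [m [n [_ Cm _]]]; exists m.
Qed.

End Order.
End Hull.

(** The clause on the order is conditional on [s], so the lemma also acts as an upward
    Löwenheim-Skolem theorem for structures that name no such order. *)
Lemma hull_exists (L : signature) (U : Type) (A : structure_on L U)
    (q : nat -> U) (I : Type) (lt : I -> I -> Prop) :
  countable [set: L] -> injective q -> well_founded lt ->
  (forall x y z, lt x y -> lt y z -> lt x z) ->
  (forall x y, [\/ lt x y, x = y | lt y x]) ->
  (forall i, exists j, lt i j) -> has_card_omega1 I ->
  exists (M : Type) (B : structure_on L M) (c : I -> M),
    [/\ has_card_omega1 M, model_of (complete_theory A) B &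
      forall s, arity s = 2 ->
        (forall t, A s t <-> exists m n, m < n /\ val t = [:: q m; q n]) ->
        [/\ forall a, ~ binrel B s a a,
            forall a b d, binrel B s a b -> binrel B s b d -> binrel B s a d,
            forall i j, lt i j -> binrel B s (c i) (c j) &
            forall a b, binrel B s a b -> exists i, binrel B s a (c i)]].
Proof.
move=> cL q_inj wf tr tot nomax cI.
have [i0 _] := uncountable_inh (proj1 cI).
have [dec dec_surj] : exists dec : nat -> formula L * nat,
    forall px, exists n, dec n = px.
  have : countable ([set: formula L] `*` [set: nat]).
    by apply: countableX => //; exact: countable_formula.
  rewrite setXTT => /countableTP[f f_inj].
  pose d n := match pselect (exists px, f px = n) with
    | left h => projT1 (cid h) | right _ => (FBot L, 0) end.
  exists d => px; exists (f px); rewrite /d.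
  by case: pselect => [h|]; [case: cid => ? /= /f_inj|case; exists px].
(* The sets of lists extending a given list generate a proper filter, and any ultrafilter above it
   satisfies [W_in]. *)
pose F := filter_from [set: seq (term I)] (fun l => [set ts | List.incl l ts]).
have properF : ProperFilter F.
  apply: filter_from_proper; last by move=> l _; exists l; exact: List.incl_refl.
  apply: filter_from_filter; first by exists [::].
  move=> l l' _ _; exists (l ++ l') => // ts h.
  by split=> t tl; apply: h; apply: List.in_or_app; [left|right].
have [W [WU FW]] := ultraFilterLemma properF.
have W_in t : W [set ts | List.In t ts].
  by apply: FW; exists [:: t] => // ts; apply; left.
pose M := @hull L U A q dec I lt wf W.
pose B : structure_on L M := @hull_structure L U A q dec I lt wf W.
pose c : I -> M := @gen L U A q dec I lt wf W.
exists M, B, c; split.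
- exact: hull_card.
- exact: hull_model.
move=> s s2 sP; split.
- exact: hull_binrel_irrefl.
- exact: hull_binrel_trans.
- move=> i j ij; apply: hull_binrel_gen => //.
  by apply: ultra_sub filterT => ts _; exists (greedy A q dec wf ts i).
- by move=> a b; exact: hull_binrel_cofinal.
Qed.

(** * Cofinality and failure of categoricity *)

Lemma omega1_no_max (X : Type) (lt : X -> X -> Prop) :
  omega1_order lt -> forall x, exists y, lt x y.
Proof.
move=> [wf tr tot init unc] x; apply: contrapT => nx; apply: unc.
apply: countable_subset (countable_closed_init (init x)) => y _ /=.
case: (tot y x) => [|->|xy]; [by left|by right|].
by case: nx; exists y.
Qed.

(** An unbounded sequence would cover [X] by countably many countable initial segments. *)
Lemma omega1_bound (X : Type) (lt : X -> X -> Prop) (f : nat -> X) :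
  omega1_order lt -> exists x, forall n, lt (f n) x.
Proof.
move=> [wf tr tot init unc]; apply: contrapT => nx; apply: unc.
apply: (@countable_subset _ _
  (\bigcup_n [set y | lt y (f n) \/ y = f n])); last first.
  by apply: bigcup_countable => // n _; exact: countable_closed_init.
move=> y _; apply: contrapT => ny; apply: nx; exists y => n.
case: (tot (f n) y) => // [fy|yf]; case: ny; exists n => //=; by [right|left].
Qed.

(** The ordinal sum with [nat] on top: over an order of type omega_1 it has cofinality omega. *)
Definition lt_add_nat (X : Type) (lt : X -> X -> Prop) (x y : X + nat) : Prop :=
  match x, y with
  | inl x, inl y => lt x y
  | inl _, inr _ => True
  | inr _, inl _ => False
  | inr m, inr n => m < n
  end.

Lemma lt_add_nat_wf (X : Type) (lt : X -> X -> Prop) :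
  well_founded lt -> well_founded (lt_add_nat lt).
Proof.
move=> wf; have accl x : Acc (lt_add_nat lt) (inl x).
  by elim/(well_founded_ind wf): x => x IH; constructor=> -[y /= /IH|].
case=> [x|n]; first exact: accl.
elim/ltn_ind: n => n IH; constructor=> -[y _|m /= mn]; first exact: accl.
exact: IH.
Qed.

Lemma isomorphic_binrel (L : signature) (U V : Type) (A : structure_on L U)
    (B : structure_on L V) (f : U -> V) (s : L) :
  bijective f -> (forall s t, A s t <-> B s (map_tuple f t)) ->
  forall a b, binrel A s a b <-> binrel B s (f a) (f b).
Proof.
move=> [g fK gK] AB a b; split=> [[t tE At]|[t tE Bt]].
  by exists (map_tuple f t); [rewrite /= tE|apply/AB].
exists (map_tuple g t); first by rewrite /= tE /= !fK.
apply/AB; rewrite map_tuple_comp.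
suff -> : map_tuple (f \o g) t = t by [].
by apply: val_inj; rewrite /= (eq_map gK) map_id.
Qed.

(* The relation [s] is an order of type omega in [A]; it has cofinality
   omega_1 in one model of cardinality omega_1, and omega in another. *)
Lemma omega_order_not_categorical (L : signature) (U : Type)
    (A : structure_on L U) (q : nat -> U) (s : L) :
  countable [set: L] -> injective q -> arity s = 2 ->
  (forall t, A s t <-> exists m n, m < n /\ val t = [:: q m; q n]) ->
  ~ omega1_categorical (complete_theory A).
Proof.
move=> cL q_inj s2 sP [X0 [A0 [_ _ cat]]].
have [X [lt oX]] := omega1_order_exists.
have cX := omega1_has_card oX; case: (oX) => wf tr tot _ _.
have [M1 [B1 [c1 [cM1 mB1 /(_ s s2 sP)[irr1 tr1 lt1 cof1]]]]] :=
  hull_exists A cL q_inj wf tr tot (omega1_no_max oX) cX.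
have wf' := lt_add_nat_wf wf.
have tr' (x y z : X + nat) :
    lt_add_nat lt x y -> lt_add_nat lt y z -> lt_add_nat lt x z.
  by case: x y z => [x|m] [y|n] [z|k] //=; [exact: tr|exact: ltn_trans].
have tot' (x y : X + nat) :
    [\/ lt_add_nat lt x y, x = y | lt_add_nat lt y x].
  case: x y => [x|m] [y|n] /=; [|by constructor 1|by constructor 3|].
    by case: (tot x y) => [?|->|?]; [constructor 1|constructor 2|constructor 3].
  by case: (ltngtP m n) => [?|?|->]; [constructor 1|constructor 3|constructor 2].
have nomax' (x : X + nat) : exists y, lt_add_nat lt x y.
  by case: x => [x|n]; [exists (inr 0)|exists (inr n.+1) => /=].
have [M2 [B2 [c2 [cM2 mB2 /(_ s s2 sP)[irr2 tr2 lt2 cof2]]]]] :=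
  hull_exists A cL q_inj wf' tr' tot' nomax' (has_card_omega1_add_nat cX).
have [f [bf fP]] := isomorphic_trans (isomorphic_sym (cat _ _ cM1 mB1))
                                     (cat _ _ cM2 mB2).
have fR := isomorphic_binrel s bf fP; have [g fK gK] := bf.
(* Through the isomorphism, the generators indexed by [nat] in the second model become cofinal in
   the first. *)
have cofn a b : binrel B1 s a b -> exists n, binrel B1 s a (g (c2 (inr n))).
  move=> /fR /cof2 [[x|n] h].
    by exists 0; apply/fR; rewrite gK; apply: tr2 h (lt2 _ _ _).
  by exists n; apply/fR; rewrite gK.
have /choice[i iP] : forall n, exists i, binrel B1 s (g (c2 (inr n))) (c1 i).
  move=> n; apply: (cof1 _ (g (c2 (inr n.+1)))); apply/fR; rewrite !gK.
  by apply: lt2; exact: ltnSn.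
(* A cycle arises: [c1 x] is below some [g (c2 (inr n))], hence below [c1 (i n)], hence below
   itself. The point [y] shows that [c1 x] lies below something, as [cofn] demands. *)
have [x xP] := omega1_bound i oX; have [y xy] := omega1_no_max oX x.
have [n xn] := cofn _ _ (lt1 _ _ xy).
exact: (irr1 _ (tr1 _ _ _ xn (tr1 _ _ _ (iP n) (lt1 _ _ (xP n))))).
Qed.

(** Existence of a model of cardinality omega_1 comes from the Skolem hull, so only uniqueness is
    left to check. *)
Lemma omega1_categorical_models (L : signature) (U : Type)
    (A : structure_on L U) : countable [set: L] -> infinite_set [set: U] ->
  (forall (Y Z : Type) (B : structure_on L Y) (C : structure_on L Z),
     has_card_omega1 Y -> has_card_omega1 Z -> model_of (complete_theory A) B ->
     model_of (complete_theory A) C -> isomorphic B C) ->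
  omega1_categorical (complete_theory A).
Proof.
move=> cL /infiniteTP[q q_inj] iso; have [X [lt oX]] := omega1_order_exists.
have cX := omega1_has_card oX; case: (oX) => wf tr tot _ _.
have [M [B [_ [cM mB _]]]] :=
  hull_exists A cL q_inj wf tr tot (omega1_no_max oX) cX.
by exists M, B; split=> // Y C cY mC; exact: iso.
Qed.

(** * Relations named by symbols *)

(** Membership of a bare sequence, so that an equality between relations can be rewritten without
    transporting tuples along an equality of arities. *)
Definition finrel_seq (U : Type) (r : finrel U) (u : seq U) : Prop :=
  exists2 t : (projT1 r).-tuple U, val t = u & projT2 r t.

Lemma interp_seq (L : signature) (U : Type) (A : structure_on L U) (s : L)
    (t : (arity s).-tuple U) : A s t <-> finrel_seq (interp A s) (val t).
Proof.
split=> [At|[t' /val_inj /= <-]] //.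
by exists t.
Qed.

Lemma countable_subsignature (L : signature) (N : set L) :
  countable N -> countable [set: subsignature N].
Proof.
move=> cN; have /countableTP [f f_inj] : countable [set: N].
  by rewrite (eq_countable (card_setT N)).
by apply/countableTP; exists f.
Qed.

Lemma finrel_seq_image (U : Type) (f : U -> U) (r : finrel U) (u : seq U) :
  injective f -> finrel_seq (rel_image f r) (map f u) <-> finrel_seq r u.
Proof.
move=> f_inj; split=> [[t' tu [t rt tt']]|[t <- rt]].
  by exists t => //; apply: (inj_map f_inj); rewrite -tu -tt'.
by exists (map_tuple f t) => //; exists t.
Qed.

(** Once each symbol is matched with the symbol naming its image, [f] itself is an isomorphism
    between the two restrictions. *)
Lemma P_omega1_cat_perm (L : signature) (U : Type) (A : structure_on L U) :
  regular A -> (forall r, exists s, interp A s = r) ->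
  closed_under_permutations A (P_omega1_cat A).
Proof.
move=> regA allA f bf N [infU cN catN].
set N' := perm_image A f N; have [g fK gK] := bf; have f_inj := can_inj fK.
have /choice[h hP] := fun s => allA (rel_image f (interp A s)).
have /choice[e eP] : forall s' : subsignature N', exists s : subsignature N,
    interp A (val s') = rel_image f (interp A (val s)).
  by move=> s'; have [s Ns sE] := set_mem (valP s'); exists (exist _ s (mem_set Ns)).
have /choice[e' e'P] : forall s : subsignature N, exists s' : subsignature N',
    interp A (val s') = rel_image f (interp A (val s)).
  move=> s.
  have N's : N' (h (val s)) by exists (val s) => //; exact: set_mem (valP s).
  by exists (exist _ (h (val s)) (mem_set N's)); exact: hP.
have ea s' : arity s' = arity (e s').
  by exact: (congr1 (fun r : finrel U => projT1 r) (eP s')).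
have ea' s : arity s = arity (e' s) 
  by exact/esym/(congr1 (fun r : finrel U => projT1 r) (e'P s)).
have eK : cancel e e'.
  by move=> s'; apply/val_inj/regA; rewrite e'P -eP.
have imE s s' (t : (arity s).-tuple U) (t' : (arity s').-tuple U) :
    interp A s' = rel_image f (interp A s) -> val t' = map f (val t) ->
    A s t <-> A s' t'.
  by move=> ss' tt'; rewrite !interp_seq ss' tt' finrel_seq_image.
split=> //.
  apply: (countable_cover cN (f := h)) => s' [s Ns sE].
  by exists s => //; apply: regA; rewrite hP.
apply: (omega1_categorical_rename (ea := ea) (ea' := ea') eK _ _ catN).
  exists f; split=> // s' t; rewrite /pullback /restriction.
  by apply: imE; rewrite ?eP //= val_tcast.
exists g; split=> [|s t]; first by exists f.
rewrite /pullback /restriction; apply: iff_sym.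
apply: (imE (val s) (val (e' s))); first exact: e'P.
by rewrite /= val_tcast -map_comp (eq_map gK) map_id.
Qed.

(** With no symbols to respect, any bijection is an isomorphism. *)
Lemma restriction_set0_categorical (L : signature) (U : Type)
    (A : structure_on L U) : infinite_set [set: U] -> P_omega1_cat A set0.
Proof.
move=> infU; split=> //; apply: omega1_categorical_models => //.
  exact: countable_subsignature.
move=> Y Z B C cY cZ _ _; have [f bf] := has_card_omega1_bij cY cZ.
by exists f; split=> // s; have := set_mem (valP s).
Qed.

Lemma omega_order_up_set (L : signature) (U : Type) (A : structure_on L U) :
  (forall r, exists s, interp A s = r) -> infinite_set [set: U] ->
  exists N : set L, finite_set N /\ up_set N `&` P_omega1_cat A = set0.
Proof.
move=> allA /infiniteTP[q q_inj].
have [s sE] := allA (existT (fun n => set (n.-tuple U)) 2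
  [set t | exists m n, m < n /\ val t = [:: q m; q n]]).
exists [set s]; split; first exact: finite_set1.
rewrite -subset0 => K [/(_ s erefl) Ks [_ cK]].
pose sK : subsignature K := exist _ s (mem_set Ks).
have s2 : arity s = 2 := congr1 (fun r : finrel U => projT1 r) sE.
apply: (omega_order_not_categorical (countable_subsignature cK) q_inj
  (s := sK)) => //.
move=> t; rewrite /restriction interp_seq sE; split=> [[u + [m [n [mn uE]]]]|].
  by rewrite uE => tE; exists m, n; rewrite tE.
move=> [m [n [mn tE]]]; exists [tuple q m; q n]; first by rewrite tE.
by exists m, n.
Qed.

(** * Bits *)

Lemma inj_surj_bij (X Y : Type) (f : X -> Y) :
  injective f -> (forall y, exists x, f x = y) -> bijective f.
Proof.
move=> f_inj /choice[g gK]; exists g => // x; apply: f_inj; exact: gK.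
Qed.

(* A maximal family of injections of [nat] with disjoint ranges leaves out
   finitely many points, which are then prepended to one of its members. *)
Lemma infinite_bij_prod_nat (U : Type) : infinite_set [set: U] ->
  exists (I : Type) (f : I * nat -> U), bijective f.
Proof.
elim/Pchoice: U => U infU.
pose P : set (set (nat -> U)) := [set F |
  (forall h, F h -> injective h) /\
  forall h h' m n, F h -> F h' -> h m = h' n -> h = h'].
have [|F [[Finj Fdis] Fmax]] := @Zorn_bigcup _ P.
  move=> C CP Ctot; split=> [h [F CF Fh]|h h' m n [F CF Fh] [F' CF' F'h']].
    by have [Pi _] := CP F CF; exact: Pi.
  have [FF'|F'F] := Ctot F F' CF CF'.
    by have [_ Pd] := CP F' CF'; apply: Pd; first exact: FF'.
  by have [_ Pd] := CP F CF; apply: Pd => //; exact: F'F.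
pose R : set U := [set u | forall h n, F h -> h n <> u].
have finR : finite_set R.
  (* An infinite remainder would contain the range of a further injection [k], against
     maximality. *)
  apply: contrapT => /infiniteP/card_leP[g].
  have nT (n : nat) : n \in [set: nat] by rewrite in_setT.
  pose k n : U := val (g (exist _ n (nT n))).
  have kR n : R (k n) by exact: set_mem (valP (g _)).
  have k_inj : injective k.
    move=> m n /val_inj /(@inj _ _ _ g) => /(_ (mem_set I) (mem_set I)).
    by case.
  have nFk : ~ F k by move=> Fk; exact: (kR 0 k 0 Fk).
  apply: (Fmax (F `|` [set k])).
    split; first by move=> h Fh; left.
    by move=> /(_ k (or_intror erefl)).
  split=> [h [/Finj //|->//]|h h' m n [Fh|->] [Fh'|->]] //; first exact: Fdis.
    by move=> hk; case: (kR n h m Fh hk).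
  by move=> /esym hk; case: (kR m h' n Fh' hk).
have /finite_seqP[s0 Rs0] := finR; pose s := undup s0.
have Rs u : R u <-> u \in s by rewrite mem_undup Rs0.
have [h0 Fh0] : exists h, F h.
  apply: contrapT => nF; apply: infU; rewrite (_ : setT = R) //.
  by apply/seteqP; split=> // u _ h n Fh; case: nF; exists h.
have hR h n u : F h -> u \in s -> h n = u -> False by move=> Fh /Rs /(_ h n Fh).
pose d u0 n := if n < size s then nth u0 s n else h0 (n - size s).
pose f (x : {h | F h} * nat) : U :=
  if pselect (sval x.1 = h0) is left _ then d (h0 0) x.2 else sval x.1 x.2.
exists {h | F h}, f; apply: inj_surj_bij.
- move=> [[h Fh] m] [[h' Fh'] n]; rewrite /f /=.
  have hh' (e : h = h') (k : nat) : (exist F h Fh, k) = (exist F h' Fh', k).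
    by congr pair; exact: eq_exist.
  case: pselect => [hh|nh]; case: pselect => [hh0|nh'].
  + rewrite /d; case: ltnP => ms; case: ltnP => ns.
    * move/eqP; rewrite nth_uniq ?undup_uniq // => /eqP ->.
      by apply: hh'; rewrite hh hh0.
    * by move/esym/(hR _ _ _ Fh0 (mem_nth _ ms)).
    * by move/(hR _ _ _ Fh0 (mem_nth _ ns)).
    * move/(Finj _ Fh0) => e; rewrite (_ : m = n); first by apply: hh'; rewrite hh hh0.
      by rewrite -(subnK ms) -(subnK ns) e.
  + rewrite /d; case: ltnP => ms; first by move/esym/(hR _ _ _ Fh' (mem_nth _ ms)).
    by move/(Fdis _ _ _ _ Fh0 Fh') => e; case: nh'.
  + rewrite /d; case: ltnP => ns; first by move/(hR _ _ _ Fh (mem_nth _ ns)).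
    by move/(Fdis _ _ _ _ Fh Fh0) => e; case: nh.
  + move=> e; have e' := Fdis _ _ _ _ Fh Fh' e.
    have -> : m = n by apply: (Finj _ Fh'); rewrite -e e'.
    exact: hh'.
- move=> u; have [su|nsu] := boolP (u \in s).
    exists (exist _ h0 Fh0, index u s); rewrite /f /=; case: pselect => // _.
    by rewrite /d index_mem su nth_index.
  have [h [n [Fh hn]]] : exists h n, F h /\ h n = u.
    apply: contrapT => nh; move/negP: nsu; apply; apply/Rs => h n Fh hn.
    by apply: nh; exists h, n.
  have [e|ne] := pselect (h = h0).
    exists (exist _ h0 Fh0, n + size s); rewrite /f /=; case: pselect => // _.
    by rewrite /d ltnNge leq_addl /= addnK -e.
  by exists (exist _ h Fh, n); rewrite /f /=; case: pselect.
Qed.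

Definition finsupp (f : nat -> bool) : Prop :=
  exists m, forall i, m <= i -> f i = false.

(** Here [b] and [d] are the two coordinates of a bijection of [U] with a product of [I] and the
    finitely supported bit functions. *)
Lemma bits_exist (U : Type) : infinite_set [set: U] ->
  exists (I : Type) (b : U -> I) (d : U -> nat -> bool),
    [/\ forall x, finsupp (d x),
        forall x y, b x = b y -> d x = d y -> x = y &
        forall x f, finsupp f -> exists2 y, b y = b x & d y = f].
Proof.
move=> /infinite_bij_prod_nat[I [f [g fK gK]]].
pose J := {f : nat -> bool | finsupp f}.
have Jinj : injective (sval : J -> nat -> bool).
  by move=> [x ?] [y ?] /=; exact: eq_exist.
(* [J] is covered by the finite bit strings and contains the indicators of single points, so it is
   countably infinite. *)
have [h [h' hK h'K]] : exists h : J -> nat, bijective h.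
  have : [set: J] #= [set: nat].
    apply: Cantor_Bernstein.
      pose nthf (s : seq bool) : nat -> bool := nth false s.
      have fin s : finsupp (nthf s) by exists (size s) => i; exact: nth_default.
      apply: (@countable_cover (seq bool) J (fun s => exist _ _ (fin s)) setT) => //.
      move=> [u [m um]] _; exists (mkseq u m) => //; apply: Jinj; apply/funext => i /=.
      have [im|mi] := ltnP i m; first by rewrite /nthf nth_mkseq.
      by rewrite /nthf nth_default ?size_mkseq // um.
    apply/card_leTP.
    have fin n : finsupp (fun m => m == n).
      by exists n.+1 => i ni; apply/negP => /eqP e; rewrite e ltnn in ni.
    exists (fun n => exist _ _ (fin n)) => m n [] /(congr1 (fun u => u m)) /=.
    by rewrite eqxx => /esym/eqP.
  move=> /card_set_bijP[h [_ h_inj h_surj]]; exists h; apply: inj_surj_bij.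
    by move=> x y; apply: h_inj; rewrite in_setT.
  by move=> n; have [x _ <-] := h_surj n Logic.I; exists x.
exists I, (fun x => (g x).1), (fun x => sval (h' (g x).2)); split.
- by move=> x; exact: proj2_sig.
- move=> x y gx /Jinj /(can_inj h'K) gy; apply: (can_inj gK).
  by case: (g x) (g y) gx gy => [? ?] [? ?] /= -> ->.
- move=> x u fin_u; exists (f ((g x).1, h (exist _ u fin_u))); first by rewrite fK.
  by rewrite fK /= hK.
Qed.

Definition unrel (L : signature) (M : Type) (B : structure_on L M) (s : L)
    (a : M) : Prop :=
  exists2 t : (arity s).-tuple M, val t = [:: a] & B s t.

Definition binary_signature (L : signature) : Prop :=
  forall s : L, arity s = 1 \/ arity s = 2.

Lemma unrelE (L : signature) (M : Type) (B : structure_on L M) (s : L) a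
    (t : (arity s).-tuple M) : val t = [:: a] -> B s t <-> unrel B s a.
Proof.
move=> tE; split=> [Bt|[t' t'E]]; first by exists t.
by rewrite (_ : t = t') //; apply: val_inj; rewrite tE t'E.
Qed.

Lemma binrelE (L : signature) (M : Type) (B : structure_on L M) (s : L) a b
    (t : (arity s).-tuple M) : val t = [:: a; b] -> B s t <-> binrel B s a b.
Proof.
move=> tE; split=> [Bt|[t' t'E]]; first by exists t.
by rewrite (_ : t = t') //; apply: val_inj; rewrite tE t'E.
Qed.

Lemma tuple1E (n : nat) (T : Type) (t : n.-tuple T) :
  n = 1 -> exists a, val t = [:: a].
Proof.
move=> n1; case: t => s /= /eqP; rewrite n1.
by case: s => [|a [|]] // _; exists a.
Qed.

Lemma tuple2E (n : nat) (T : Type) (t : n.-tuple T) :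
  n = 2 -> exists a b, val t = [:: a; b].
Proof.
move=> n2; case: t => s /= /eqP; rewrite n2.
by case: s => [|a [|b [|]]] // _; exists a, b.
Qed.

Lemma binary_isomorphic (L : signature) (U V : Type) (A : structure_on L U)
    (B : structure_on L V) (f : U -> V) :
  binary_signature L -> bijective f ->
  (forall s a, arity s = 1 -> unrel A s a <-> unrel B s (f a)) ->
  (forall s a b, arity s = 2 -> binrel A s a b <-> binrel B s (f a) (f b)) ->
  isomorphic A B.
Proof.
move=> ar bf f1 f2; exists f; split=> // s t; case: (ar s) => sn.
  have [a tE] := tuple1E t sn.
  by rewrite (unrelE _ tE) f1 // -(unrelE _ (t := map_tuple f t)) //= tE.
have [a [b tE]] := tuple2E t sn.
by rewrite (binrelE _ tE) f2 // -(binrelE _ (t := map_tuple f t)) //= tE.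
Qed.

(** The length of the tuple selects the clause, so no case analysis on the arity is needed. *)
Definition binary_structure (L : signature) (M : Type) (u : L -> M -> Prop)
    (r : L -> M -> M -> Prop) : structure_on L M :=
  fun s t => (exists2 a, val t = [:: a] & u s a) \/
             (exists a b, val t = [:: a; b] /\ r s a b).

Lemma unrel_binary_structure (L : signature) (M : Type) u r (s : L) (a : M) :
  arity s = 1 -> unrel (binary_structure u r) s a <-> u s a.
Proof.
move=> s1; split=> [[t tE]|ua].
  by case=> [[a' + ua']|[a' [b' []]]]; rewrite tE // => -[->].
exists (tcast (esym s1) [tuple a]); rewrite /= ?val_tcast //.
by left; exists a; rewrite //= val_tcast.
Qed.

Lemma binrel_binary_structure (L : signature) (M : Type) u r (s : L) (a b : M) :
  arity s = 2 -> binrel (binary_structure u r) s a b <-> r s a b.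
Proof.
move=> s1; split=> [[t tE]|rab].
  by case=> [[a' + ua']|[a' [b' [+ rab]]]]; rewrite tE // => -[-> ->].
exists (tcast (esym s1) [tuple a; b]); rewrite /= ?val_tcast //.
by right; exists a, b; rewrite /= val_tcast.
Qed.

(** Each point satisfies at most one of the [R n], so a finite list excludes finitely many indices.
    This supplies classes not met so far in the back-and-forth. *)
Lemma fresh_index (Y : Type) (R : nat -> Y -> Prop) (w : nat -> Y) (S : seq nat) :
  (forall m n y, R m y -> R n y -> m = n) ->
  exists n, forall x, x \in S -> ~ R n (w x).
Proof.
move=> Rinj; suff [m mP] : exists m, forall n x, m <= n -> x \in S -> ~ R n (w x).
  by exists m => x; exact: mP.
elim: S => [|x S [m mP]]; first by exists 0.
have [[k Rk]|nR] := pselect (exists k, R k (w x)).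
  exists (maxn m k.+1) => n y; rewrite geq_max inE => /andP[mn kn] /orP[/eqP ->|].
    by move=> /(Rinj _ _ _ Rk) e; rewrite e ltnn in kn.
  exact: mP.
exists m => n y mn; rewrite inE => /orP[/eqP -> Rn|]; last exact: mP.
by apply: nR; exists n.
Qed.

Definition same_tail (U I : Type) (b : U -> I) (d : U -> nat -> bool) (j : nat)
    (x y : U) : Prop :=
  b x = b y /\ forall i, j <= i -> d x i = d y i.

(** * Bits with a free colour *)

Section FreeColour.
Variables (L : signature) (U I : Type) (A : structure_on L U).
Variables (b : U -> I) (d : U -> nat -> bool) (u0 : U) (k : nat).
Hypothesis d_fin : forall x, finsupp (d x).
Hypothesis bd_inj : forall x y, b x = b y -> d x = d y -> x = y.
Hypothesis bd_surj : forall x f, finsupp f -> exists2 y, b y = b x & d y = f.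
Variable idx : L -> nat.
Hypothesis idx_le : forall s, idx s <= k.
Hypothesis A_un : forall s, arity s = 1 -> forall x, unrel A s x <-> d x (idx s).
Hypothesis A_bin : forall s, arity s = 2 ->
  forall x y, binrel A s x y <-> same_tail b d (idx s) x y.
Hypothesis arL : binary_signature L.

(** [T] is the set of classes of the new model, each class a full cube of [k] bits, and [col] gives
    the value of bit [k], constant on each class. Only the infinity of both colours is imposed;
    their cardinalities stay free. *)
Variables (T : Type) (col : T -> bool).
Hypothesis col_inf : forall c, exists z : nat -> T,
  injective z /\ forall n, col (z n) = c.

Let V : Type := T * k.-tuple bool.

(** Bit [k] is the colour; the value at larger indices is a mere default, since all symbols have
    index at most [k]. *)
Definition vbit (x : V) (i : nat) : bool :=
  if i < k then nth false x.2 i else col x.1.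

Definition vtail (j : nat) (x y : V) : Prop :=
  x.1 = y.1 /\ forall i, j <= i -> i < k -> vbit x i = vbit y i.

Definition coloured : structure_on L V :=
  binary_structure (fun s x => vbit x (idx s)) (fun s => vtail (idx s)).

Lemma vbit_inj (x y : V) :
  x.1 = y.1 -> (forall i, i < k -> vbit x i = vbit y i) -> x = y.
Proof.
case: x y => [t f] [t' f'] /= -> h; congr pair; apply: val_inj.
apply: (@eq_from_nth _ false); rewrite ?size_tuple // => i ik.
by have := h i ik; rewrite /vbit ik.
Qed.

Lemma vbit_col (x : V) : vbit x k = col x.1.
Proof. by rewrite /vbit ltnn. Qed.

Lemma vbit_surj (t : T) (f : nat -> bool) : exists x : V,
  x.1 = t /\ forall i, i < k -> vbit x i = f i.
Proof.
exists (t, [tuple f i | i < k]); split=> // i ik; rewrite /vbit ik /=.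
rewrite (nth_map (Ordinal ik)) ?size_enum_ord //; congr f.
exact: (nth_enum_ord (Ordinal ik) ik).
Qed.

Lemma tail_inj x y :
  same_tail b d k x y -> (forall i, i < k -> d x i = d y i) -> x = y.
Proof.
move=> [bxy dxy] h; apply: bd_inj => //; apply/funext => i.
by have [/h|/dxy] := ltnP i k.
Qed.

Lemma tail_le j x y : j <= k -> same_tail b d j x y <->
  same_tail b d k x y /\ forall i, j <= i -> i < k -> d x i = d y i.
Proof.
move=> jk; split=> [[bxy dxy]|[[bxy dxy] h]]; split=> //.
- by split=> // i ki; apply: dxy; exact: leq_trans ki.
- by move=> i ji _; exact: dxy.
- by move=> i ji; have [/(h i ji)|/dxy] := ltnP i k.
Qed.

Lemma tail_sym j x y : same_tail b d j x y -> same_tail b d j y x.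
Proof. by case=> bxy dxy; split=> // i /dxy. Qed.

Lemma tail_trans j x y z :
  same_tail b d j x y -> same_tail b d j y z -> same_tail b d j x z.
Proof.
case=> bxy dxy [byz dyz]; split=> [|i ji]; first by rewrite bxy.
by rewrite dxy // dyz.
Qed.

Lemma tail_fill x (f : nat -> bool) : exists y,
  same_tail b d k y x /\ forall i, i < k -> d y i = f i.
Proof.
have [m mP] := d_fin x.
have [|y byx dy] := @bd_surj x (fun i => if i < k then f i else d x i).
  exists (maxn m k) => i; rewrite geq_max => /andP[mi ki].
  by rewrite ltnNge ki /= mP.
exists y; rewrite /same_tail dy; split=> [|i ->] //; split=> // i ki.
by rewrite ltnNge ki.
Qed.

(** Agreement of the bits up to [k] and of the partition into classes determines equality and all
    atoms, so these conditions suffice for the back-and-forth. *)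
Definition matched (x : U) (y : V) : Prop := forall i, i <= k -> d x i = vbit y i.

Definition coherent (S : seq nat) (v : nat -> U) (w : nat -> V) : Prop :=
  (forall x, x \in S -> matched (v x) (w x)) /\
  forall x y, x \in S -> y \in S ->
    same_tail b d k (v x) (v y) <-> (w x).1 = (w y).1.

Lemma coherent_with S v w x a c : coherent S v w -> matched a c ->
  (forall y, y \in S -> same_tail b d k a (v y) <-> c.1 = (w y).1) ->
  coherent (x :: S) [eta v with x |-> a] [eta w with x |-> c].
Proof.
move=> [vw1 vw2] ac acS.
have xS y : y \in x :: S -> y <> x -> y \in S by rewrite inE => /orP[/eqP|].
split=> [y yS|y z yS zS] /=.
  by case: eqP => // /xS-/(_ yS)/vw1.
case: (y =P x) => [_|/(xS _ yS) yS']; case: (z =P x) => [_|/(xS _ zS) zS'].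
- by split.
- exact: acS.
- split=> [/tail_sym/acS ->//|/esym e].
  by apply/tail_sym/acS.
- exact: vw2.
Qed.

Lemma coherent_forth S v w x a : coherent S v w ->
  exists c, coherent (x :: S) [eta v with x |-> a] [eta w with x |-> c].
Proof.
move=> vw; have [vw1 vw2] := vw.
have [[y [yS ay]]|na] := pselect (exists y, y \in S /\ same_tail b d k a (v y)).
  have [c [c1 cbit]] := vbit_surj (w y).1 (d a); exists c.
  apply: coherent_with => // [i|z zS].
    rewrite leq_eqVlt => /orP[/eqP ->|/cbit //].
    by rewrite vbit_col c1 -vbit_col -vw1 //; have [_ ->] := ay.
  rewrite c1 -vw2 //; split; last exact: tail_trans.
  by apply: tail_trans; exact: tail_sym.
have [z [z_inj zcol]] := col_inf (d a k).
have [|n nP] := fresh_index (R := fun n y => z n = y) (fun y => (w y).1) S.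
  by move=> m n y <- /z_inj.
have [c [c1 cbit]] := vbit_surj (z n) (d a); exists c.
apply: coherent_with => // [i|y yS].
  rewrite leq_eqVlt => /orP[/eqP ->|/cbit //].
  by rewrite vbit_col c1 zcol.
rewrite c1; split=> [ay|/nP]; last by move/(_ yS).
by case: na; exists y.
Qed.

(* New classes are obtained by switching on one bit beyond [k]. *)
Lemma coherent_back S v w x c : coherent S v w ->
  exists a, coherent (x :: S) [eta v with x |-> a] [eta w with x |-> c].
Proof.
move=> vw; have [vw1 vw2] := vw.
have [[y [yS cy]]|nc] := pselect (exists y, y \in S /\ c.1 = (w y).1).
  have [a [ay abit]] := tail_fill (v y) (vbit c); exists a.
  apply: coherent_with => // [i|z zS].
    rewrite leq_eqVlt => /orP[/eqP ->|/abit //].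
    by rewrite vbit_col cy -vbit_col -vw1 //; have [_ ->] := ay.
  rewrite cy -vw2 //; split; last exact: tail_trans.
  by apply: tail_trans; exact: tail_sym.
have /choice[z zP] : forall n, exists a : U, d a =
    fun i => if i <= k then vbit c i else i == (k + n).+1.
  move=> n.
  have [|a _ da] := @bd_surj u0
      (fun i => if i <= k then vbit c i else i == (k + n).+1).
    exists (k + n).+2 => i ki.
    rewrite leqNgt (leq_trans _ ki) ?ltnS ?leq_addr //=; last first.
      by rewrite leqW ?leq_addr.
    by apply/eqP => e; rewrite e ltnn in ki.
  by exists a.
have [|n nP] := fresh_index (R := fun n y => same_tail b d k (z n) y) v S.
  move=> m n y my /tail_sym ny; have [_] := tail_trans my ny.
  move=> /(_ (k + m).+1); rewrite !zP ltnNge leq_addr /= eqxx.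
  by rewrite (leq_trans (leq_addr m k)) // => /(_ isT)/esym/eqP[] /addnI.
exists (z n); apply: coherent_with => // [i ik|y yS]; first by rewrite zP ik.
split=> [/nP|e]; first by move/(_ yS).
by case: nc; exists y.
Qed.

Lemma coloured_model : model_of (complete_theory A) coloured.
Proof.
move=> p [sp pA] w.
suff <- : sat A (fun _ => u0) p <-> sat coloured w p by exact: pA.
apply: (@back_and_forth _ _ _ A coloured coherent _ _ _ _ p [::]).
- move=> S v {}w x y [vw1 vw2] xS yS; split=> [e|e].
    apply: vbit_inj => [|i ik]; first by apply/vw2 => //; rewrite e.
    by rewrite -!vw1 ?e // ltnW.
  apply: tail_inj => [|i ik]; first by apply/vw2 => //; rewrite e.
  by rewrite !vw1 ?e // ltnW.
- move=> S v {}w s t [vw1 vw2] tS; case: (arL s) => sn.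
    have [x tE] := tuple1E t sn.
    rewrite (unrelE A (a := v x)) /= ?tE // (unrelE _ (a := w x)) /= ?tE //.
    rewrite A_un // unrel_binary_structure // vw1 //.
    by apply: tS; rewrite memtE tE mem_head.
  have [x [y tE]] := tuple2E t sn.
  have xS : x \in S by apply: tS; rewrite memtE tE mem_head.
  have yS : y \in S by apply: tS; rewrite memtE tE !inE eqxx orbT.
  rewrite (binrelE A (a := v x) (b := v y)) /= ?tE //.
  rewrite (binrelE _ (a := w x) (b := w y)) /= ?tE //.
  rewrite A_bin // binrel_binary_structure // tail_le // vw2 //.
  split=> -[e h]; split=> // i si ik; have := h i si ik;
  by rewrite -!vw1 // ltnW.
- exact: coherent_forth.
- exact: coherent_back.
- by split.
- by move=> x; rewrite (negbTE (sp x)).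
Qed.

End FreeColour.

Lemma has_card_omega1_prod (X Y : Type) (y0 : Y) :
  has_card_omega1 X -> countable [set: Y] -> has_card_omega1 (X * Y).
Proof.
move=> cX cY; apply: (has_card_omega1_fibers (rk := fst) cX).
  move=> x; apply: (countable_cover cY (f := pair x)) => -[x' y] /= <-.
  by exists y.
case: cX => ucX _ /countableTP[f f_inj]; apply: ucX; apply/countableTP.
by exists (fun x => f (x, y0)) => x x' /f_inj [].
Qed.

(** In the model for [c], countably many classes have colour [c] and omega_1 many the other colour.
    An isomorphism from the model for [true] to the model for [false] would preserve bit [k] and
    exchange the two cardinalities. *)
Lemma free_colour_not_categorical (L : signature) (U I : Type)
    (A : structure_on L U) (b : U -> I) (d : U -> nat -> bool) (u0 : U)
    (k : nat) (idx : L -> nat) (s0 : L) :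
  (forall x, finsupp (d x)) ->
  (forall x y, b x = b y -> d x = d y -> x = y) ->
  (forall x f, finsupp f -> exists2 y, b y = b x & d y = f) ->
  (forall s, idx s <= k) ->
  (forall s, arity s = 1 -> forall x, unrel A s x <-> d x (idx s)) ->
  (forall s, arity s = 2 ->
    forall x y, binrel A s x y <-> same_tail b d (idx s) x y) ->
  binary_signature L -> arity s0 = 1 -> idx s0 = k ->
  ~ omega1_categorical (complete_theory A).
Proof.
move=> d_fin bd_inj bd_surj idx_le A_un A_bin arL s01 s0k [X0 [A0 [_ _ cat]]].
have [X [lt oX]] := omega1_order_exists; have cX := omega1_has_card oX.
have [ucX _] := cX; have /infiniteTP[e e_inj] := uncountable_infinite ucX.
pose T : Type := (X + nat)%type.
pose col c (t : T) : bool := if t is inl _ then ~~ c else c.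
have col_inf c c' : exists z : nat -> T, injective z /\ forall n, col c (z n) = c'.
  have [->|ne] := eqVneq c' c; first by exists inr; split=> // m n [].
  exists (inl \o e); split=> [m n [] /e_inj //|n] /=.
  by case: c c' ne => [] [].
have cT : has_card_omega1 T := has_card_omega1_add_nat cX.
have cV := has_card_omega1_prod (nseq_tuple k false) cT (countableP _).
have isoc c := cat _ _ cV (coloured_model u0 d_fin bd_inj bd_surj idx_le A_un
  A_bin arL (col_inf c)).
have [f [bf fP]] := isomorphic_trans (isomorphic_sym (isoc true)) (isoc false).
have colf x : col true x.1 = col false (f x).1.
  pose t := tcast (esym s01) [tuple x].
  have tE : val t = [:: x] by rewrite /= val_tcast.
  have := fP s0 t; rewrite (unrelE _ tE) (unrelE _ (a := f x)) /= ?tE //.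
  rewrite !unrel_binary_structure // s0k !vbit_col => h.
  by apply/idP/idP => /h.
apply: ucX; have [g fK gK] := bf.
(* The points over [inl x] have colour [true] in the second model, so [g] embeds an uncountable set
   into the countable part of colour [true] in the first. *)
pose F x := g (inl x, nseq_tuple k false).
have F_inj : injective F by move=> x y /(can_inj gK) [].
apply: countable_subset (countable_preimage F_inj (A := [set y | col true y.1]) _).
  by move=> x _ /=; rewrite colf gK.
apply: (@countable_cover (nat * k.-tuple bool) _
  (fun y => (inr y.1, y.2)) setT) => // -[[x|n] t] //= _.
by exists (n, t).
Qed.

(** * Bits shared by all classes *)

(** The last two axioms identify each class of [E] with the full cube of [k] bits. *)
Record bit_axioms (Y : Type) (k : nat) (E : Y -> Y -> Prop)
    (p : nat -> Y -> Prop) : Prop := BitAxioms {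
  bit_refl : forall x, E x x;
  bit_sym : forall x y, E x y -> E y x;
  bit_trans : forall x y z, E x y -> E y z -> E x z;
  bit_inj : forall x y, E x y -> (forall i, i < k -> p i x <-> p i y) -> x = y;
  bit_fill : forall x (f : nat -> bool),
    exists y, E x y /\ forall i, i < k -> p i y <-> f i }.

(** These points form a transversal of the classes, which takes the place of a quotient. *)
Definition zero_bits (Y : Type) (k : nat) (p : nat -> Y -> Prop) (y : Y) : Prop :=
  forall i, i < k -> ~ p i y.

Lemma zero_bits_exist (Y : Type) k E (p : nat -> Y -> Prop) :
  bit_axioms k E p -> forall y, exists z, zero_bits k p z /\ E z y.
Proof.
move=> ax y; have [z [yz zP]] := bit_fill ax y (fun _ => false).
by exists z; split=> [i ik /(zP i ik)|] //; exact: (bit_sym ax).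
Qed.

Lemma zero_bits_inj (Y : Type) k E (p : nat -> Y -> Prop) y z :
  bit_axioms k E p -> zero_bits k p y -> zero_bits k p z -> E y z -> y = z.
Proof.
move=> ax y0 z0 /(bit_inj ax); apply=> i ik.
by split=> [/(y0 i ik)|/(z0 i ik)].
Qed.

(** A point is determined by the representative of its class and its [k] bits, so a countable
    transversal would make [Y] countable. *)
Lemma zero_bits_card (Y : Type) k E (p : nat -> Y -> Prop) :
  bit_axioms k E p -> has_card_omega1 Y ->
  has_card_omega1 {y | zero_bits k p y}.
Proof.
move=> ax cY; apply: (has_card_omega1_le (f := sval)) (cY).
  by move=> [x ?] [y ?] /=; exact: eq_exist.
move=> c0; have [ucY _] := cY; apply: ucY.
have /choice[r rP] := zero_bits_exist ax.
have : countable ([set: {y | zero_bits k p y}] `*` [set: k.-tuple bool]).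
  exact: countableX.
rewrite setXTT => /countableTP[f f_inj]; apply/countableTP.
pose code y := (exist (zero_bits k p) _ (rP y).1, [tuple `[< p i y >] | i < k]).
exists (f \o code) => x y /f_inj cxy; apply: (bit_inj ax).
  have rxy : r x = r y := congr1 (fun c => sval c.1) cxy.
  by apply: (bit_trans ax) (bit_sym ax (rP x).2) _; rewrite rxy; exact: (rP y).2.
move=> i ik; have := congr1 (fun c => tnth c.2 (Ordinal ik)) cxy.
rewrite !tnth_mktuple /= => e.
by split=> /asboolP; [rewrite e|rewrite -e] => /asboolP.
Qed.

Section BitIso.
Variables (Y Z : Type) (k : nat) (E : Y -> Y -> Prop) (p : nat -> Y -> Prop).
Variables (E' : Z -> Z -> Prop) (p' : nat -> Z -> Prop).
Hypotheses (ax : bit_axioms k E p) (ax' : bit_axioms k E' p').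
Variable h : {y | zero_bits k p y} -> {z | zero_bits k p' z}.

(** The extension of [h] to all points is built as a relation. Its symmetry lets each property be
    proved on one side and reused for the inverse. *)
Definition bit_match (y : Y) (z : Z) : Prop :=
  (forall i, i < k -> p i y <-> p' i z) /\
  exists y0, E (sval y0) y /\ E' (sval (h y0)) z.

Lemma bit_match_total y : exists z, bit_match y z.
Proof.
have [y0 [z0 Ey0]] := zero_bits_exist ax y.
have [z [Ez zP]] := bit_fill ax' (sval (h (exist _ y0 z0))) (fun i => `[< p i y >]).
exists z; split=> [i ik|]; last by exists (exist _ y0 z0).
by rewrite zP //; split=> [?|/asboolP //]; exact/asboolP.
Qed.

Lemma bit_match_E y y' z z' :
  bit_match y z -> bit_match y' z' -> E y y' -> E' z z'.
Proof.
move=> [_ [y0 [Ey Ez]]] [_ [y0' [Ey' Ez']]] yy'.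
have y00 : y0 = y0'.
  case: y0 y0' Ey Ey' {Ez Ez'} => [u u0] [u' u0'] /= Ey Ey'; apply: eq_exist.
  apply: (zero_bits_inj ax) => //; apply: (bit_trans ax) Ey _.
  exact: (bit_trans ax) yy' (bit_sym ax Ey').
by apply: (bit_trans ax') (bit_sym ax' Ez) _; rewrite y00.
Qed.

Lemma bit_match_fun y z z' : bit_match y z -> bit_match y z' -> z = z'.
Proof.
move=> yz yz'; apply: (bit_inj ax').
  exact: bit_match_E yz yz' (bit_refl ax y).
by move=> i ik; rewrite -(yz.1 i ik) -(yz'.1 i ik).
Qed.

End BitIso.

Lemma bit_axioms_iso (Y Z : Type) (k : nat) (E : Y -> Y -> Prop)
    (p : nat -> Y -> Prop) (E' : Z -> Z -> Prop) (p' : nat -> Z -> Prop) :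
  bit_axioms k E p -> bit_axioms k E' p' ->
  has_card_omega1 Y -> has_card_omega1 Z ->
  exists f : Y -> Z, [/\ bijective f,
    forall y y', E y y' <-> E' (f y) (f y') &
    forall i y, i < k -> p i y <-> p' i (f y)].
Proof.
move=> ax ax' cY cZ.
have [h [h' hK h'K]] :=
  has_card_omega1_bij (zero_bits_card ax cY) (zero_bits_card ax' cZ).
have sym y z : bit_match E E' h y z <-> bit_match E' E h' z y.
  split=> -[pp [u [Eu Eu']]]; split=> [i ik|]; rewrite ?pp //.
    by exists (h u); rewrite hK.
  by exists (h' u); rewrite h'K.
have /choice[f fP] := bit_match_total ax ax' h.
have /choice[g gP] := bit_match_total ax' ax h'.
exists f; split.
- exists g => [y|z].
    exact: (bit_match_fun ax' ax (gP (f y))) ((sym _ _).1 (fP y)).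
  exact: (bit_match_fun ax ax' (fP (g z))) ((sym _ _).2 (gP z)).
- move=> y y'; split; first exact: (bit_match_E ax ax' (fP y) (fP y')).
  exact: (bit_match_E ax' ax ((sym _ _).1 (fP y)) ((sym _ _).1 (fP y'))).
- by move=> i y ik; exact: (fP y).1.
Qed.

(** * First-order axioms for the bits *)

Section Connectives.
Variable L : signature.

Definition fnot (p : formula L) : formula L := FImp p (FBot L).
Definition fand (p q : formula L) : formula L := fnot (FImp p (fnot q)).
Definition fiff (p q : formula L) : formula L := fand (FImp p q) (FImp q p).
Definition fex (x : nat) (p : formula L) : formula L := fnot (FAll x (fnot p)).
Definition fall (l : seq nat) (F : nat -> formula L) : formula L :=
  foldr (fun i => fand (F i)) (fnot (FBot L)) l.

(* Only meaningful for symbols of arity 1 (applied to [x]) and 2. *)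
Definition fatom (s : L) (x y : nat) : formula L :=
  FAtom [tuple (if (i : nat) == 0 then x else y) | i < arity s].

Variables (U : Type) (A : structure_on L U) (v : nat -> U).

Lemma sat_imp p q : sat A v (FImp p q) <-> (sat A v p -> sat A v q).
Proof. by []. Qed.

Lemma sat_and p q : sat A v (fand p q) <-> sat A v p /\ sat A v q.
Proof.
split=> [h|[hp hq] /= /(_ hp)]; last exact.
by split; apply: contrapT => n; apply: h => //= hp /n.
Qed.

Lemma sat_iff p q : sat A v (fiff p q) <-> (sat A v p <-> sat A v q).
Proof. by rewrite sat_and. Qed.

Lemma sat_all l F : sat A v (fall l F) <-> forall i, i \in l -> sat A v (F i).
Proof.
elim: l => [|i l IH]; first by split=> // _ [].
rewrite [fall _ _]/= sat_and IH; split=> [[hi hl] j|h].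
  by rewrite inE => /orP[/eqP ->|/hl].
by split=> [|j jl]; apply: h; rewrite inE ?eqxx ?jl ?orbT.
Qed.

Lemma sat_ex x p :
  sat A v (fex x p) <-> exists a, sat A [eta v with x |-> a] p.
Proof.
split=> [h|[a pa] /= /(_ a)]; last exact.
by apply: contrapT => n; apply: h => a /= pa; apply: n; exists a.
Qed.

Lemma val_atom_tuple (n x y : nat) :
  val [tuple (if (i : nat) == 0 then x else y) | i < n] =
  [seq if i == 0 then x else y | i <- iota 0 n].
Proof. by rewrite /= -val_enum_ord -map_comp. Qed.

Lemma sat_atom1 s x y : arity s = 1 -> sat A v (fatom s x y) <-> unrel A s (v x).
Proof.
move=> s1; apply: unrelE.
by rewrite -[LHS]/(map v (val _)) val_atom_tuple s1.
Qed.

Lemma sat_atom2 s x y :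
  arity s = 2 -> sat A v (fatom s x y) <-> binrel A s (v x) (v y).
Proof.
move=> s2; apply: binrelE.
by rewrite -[LHS]/(map v (val _)) val_atom_tuple s2.
Qed.

End Connectives.

Section BitModel.
Variables (L : signature) (k : nat) (idx : L -> nat) (sE : L) (sP : nat -> L).
Hypothesis sE2 : arity sE = 2.
Hypothesis sP1 : forall i, i < k -> arity (sP i) = 1.
Hypothesis idx1 : forall s, arity s = 1 -> idx s < k.
Hypothesis arL : binary_signature L.

(** Every symbol is definable from [sE] and the [sP i], so a bijection respecting these is an
    isomorphism. *)
Record bit_model (Y : Type) (M : structure_on L Y) : Prop := BitModel {
  bit_model_axioms : bit_axioms k (binrel M sE) (fun i => unrel M (sP i));
  bit_model_un : forall s x, arity s = 1 ->
    unrel M s x <-> unrel M (sP (idx s)) x;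
  bit_model_bin : forall s x y, arity s = 2 ->
    binrel M s x y <-> binrel M sE x y /\
      forall i, idx s <= i < k -> unrel M (sP i) x <-> unrel M (sP i) y }.

Let same_bits (m : nat) : formula L :=
  fall [seq i <- iota 0 k | m <= i]
       (fun i => fiff (fatom (sP i) 0 0) (fatom (sP i) 1 1)).

Let sat_same_bits (Y : Type) (M : structure_on L Y) v m :
  sat M v (same_bits m) <->
  forall i, m <= i < k -> unrel M (sP i) (v 0) <-> unrel M (sP i) (v 1).
Proof.
rewrite sat_all; split=> h i.
  move=> /andP[mi ik]; have := h i; rewrite mem_filter mi mem_iota ik => /(_ isT).
  by rewrite sat_iff !sat_atom1 // sP1.
move=> il; have mik : m <= i < k by move: il; rewrite mem_filter mem_iota.
by rewrite sat_iff !sat_atom1 ?h // sP1 //; case/andP: mik.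
Qed.

(** Quantifying over [f] is not first-order, but each fixed [f] gives one formula, as only its
    values below [k] enter. *)
Let fills (f : nat -> bool) : formula L :=
  fex 1 (fand (fatom sE 0 1) (fall (iota 0 k)
    (fun i => if f i then fatom (sP i) 1 1 else fnot (fatom (sP i) 1 1)))).

Let sat_fills (Y : Type) (M : structure_on L Y) v f :
  sat M v (fills f) <-> exists y, binrel M sE (v 0) y /\
    forall i, i < k -> unrel M (sP i) y <-> f i.
Proof.
have bitE y i : i < k ->
    (sat M [eta v with 1 |-> y] (if f i then fatom (sP i) 1 1
       else fnot (fatom (sP i) 1 1)) <-> (unrel M (sP i) y <-> f i)).
  move=> ik; have := @sat_atom1 _ _ M [eta v with 1 |-> y] (sP i) 1 1 (sP1 ik).
  case: (f i) => /= <-; first by split=> // h; exact/h.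
  by split=> [h|h /h //]; split.
rewrite sat_ex; split=> -[y].
  rewrite sat_and sat_atom2 // sat_all => -[Ey h]; exists y; split=> // i ik.
  by apply/bitE => //; apply: h; rewrite mem_iota.
move=> [Ey h]; exists y; rewrite sat_and sat_atom2 // sat_all; split=> // i il.
have ik : i < k by move: il; rewrite mem_iota.
by apply/(bitE y i ik)/h.
Qed.

Lemma bit_model_transfer (U Y : Type) (A : structure_on L U)
    (B : structure_on L Y) :
  model_of (complete_theory A) B -> bit_model A -> bit_model B.
Proof.
move=> mB [ax un bin].
have tr (p : formula L) : (forall v, sat A v p) -> forall v, sat B v p.
  exact: model_of_holds mB.
pose E x y := fatom sE x y.
(* The axioms use the variables 0, 1 and 2 only. *)
pose val3 (x y z : Y) (n : nat) := if n is n'.+1 then if n' is 0 then y else z else x.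
split; first split.
- move=> x; have := tr (E 0 0) _ (val3 x x x); rewrite sat_atom2 //; apply=> v.
  by rewrite sat_atom2 //; exact: (bit_refl ax).
- move=> x y; have := tr (FImp (E 0 1) (E 1 0)) _ (val3 x y y).
  rewrite sat_imp !sat_atom2 //; apply=> v.
  by rewrite sat_imp !sat_atom2 //; exact: (bit_sym ax).
- move=> x y z.
  have := tr (FImp (E 0 1) (FImp (E 1 2) (E 0 2))) _ (val3 x y z).
  rewrite !sat_imp !sat_atom2 //; apply=> v.
  by rewrite !sat_imp !sat_atom2 //; exact: (bit_trans ax).
- move=> x y.
  have := tr (FImp (E 0 1) (FImp (same_bits 0) (FEq L 0 1))) _ (val3 x y y).
  rewrite !sat_imp !sat_atom2 // sat_same_bits; apply=> v.
  by rewrite !sat_imp !sat_atom2 // sat_same_bits; exact: (bit_inj ax).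
- move=> x f; have := tr (fills f) _ (val3 x x x); rewrite sat_fills; apply=> v.
  by rewrite sat_fills; exact: (bit_fill ax).
- move=> s x s1; have ik := idx1 s1.
  have := tr (fiff (fatom s 0 0) (fatom (sP (idx s)) 0 0)) _ (val3 x x x).
  rewrite sat_iff !sat_atom1 ?sP1 //; apply=> v.
  by rewrite sat_iff !sat_atom1 ?sP1 //; exact: un.
- move=> s x y s2.
  have := tr (fiff (fatom s 0 1) (fand (E 0 1) (same_bits (idx s)))) _ (val3 x y y).
  rewrite sat_iff sat_and !sat_atom2 // sat_same_bits; apply=> v.
  by rewrite sat_iff sat_and !sat_atom2 // sat_same_bits; exact: bin.
Qed.

Lemma bit_model_categorical (U : Type) (A : structure_on L U) :
  countable [set: L] -> infinite_set [set: U] -> bit_model A ->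
  omega1_categorical (complete_theory A).
Proof.
move=> cL infU bA; apply: omega1_categorical_models => // Y Z B C cY cZ mB mC.
have [axB unB binB] := bit_model_transfer mB bA.
have [axC unC binC] := bit_model_transfer mC bA.
have [f [bf fE fP]] := bit_axioms_iso axB axC cY cZ.
apply: (binary_isomorphic (f := f) arL bf) => [s x s1|s x y s2].
  by rewrite unB // unC //; apply: fP; exact: idx1.
rewrite binB // binC // -fE; split=> -[h hi]; split=> // i iik;
by have := hi i iik; have /andP[_ ik] := iik; rewrite -?fP // -!fP.
Qed.

End BitModel.

(** * The alternating chain *)

Lemma arity_val (L : signature) (N : set L) (s : subsignature N) :
  arity s = arity (val s).
Proof. by []. Qed.

Section Chain.
Variables (L : signature) (U I : Type) (A : structure_on L U).
Variables (b : U -> I) (d : U -> nat -> bool) (u0 : U).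
Hypothesis infU : infinite_set [set: U].
Hypothesis d_fin : forall x, finsupp (d x).
Hypothesis bd_inj : forall x y, b x = b y -> d x = d y -> x = y.
Hypothesis bd_surj : forall x f, finsupp f -> exists2 y, b y = b x & d y = f.
Variables sP sE : nat -> L.
Hypothesis sPE : forall i, interp A (sP i) =
  existT (fun n => set (n.-tuple U)) 1
    [set t | exists2 x, val t = [:: x] & d x i].
Hypothesis sEE : forall j, interp A (sE j) =
  existT (fun n => set (n.-tuple U)) 2
    [set t | exists x y, val t = [:: x; y] /\ same_tail b d j x y].

Lemma sP_arity i : arity (sP i) = 1.
Proof. exact: (congr1 (fun r : finrel U => projT1 r) (sPE i)). Qed.

Lemma sE_arity j : arity (sE j) = 2.
Proof. exact: (congr1 (fun r : finrel U => projT1 r) (sEE j)). Qed.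

Lemma sP_unrel i x : unrel A (sP i) x <-> d x i.
Proof.
change (finrel_seq (interp A (sP i)) [:: x] <-> d x i); rewrite sPE.
split=> [[t tE [y]]|dx]; first by rewrite tE => -[<-].
by exists [tuple x] => //; exists x.
Qed.

Lemma sE_binrel j x y : binrel A (sE j) x y <-> same_tail b d j x y.
Proof.
change (finrel_seq (interp A (sE j)) [:: x; y] <-> same_tail b d j x y).
rewrite sEE; split=> [[t tE [x' [y' []]]]|dx]; first by rewrite tE => -[<- <-].
by exists [tuple x; y] => //; exists x, y.
Qed.

Lemma finsupp_eq k : finsupp (fun m => m == k).
Proof. by exists k.+1 => i ki; apply/eqP => e; rewrite e ltnn in ki. Qed.

Lemma sP_inj : injective sP.
Proof.
move=> i j ij; have [x _ dx] := bd_surj u0 (finsupp_eq i).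
have : unrel A (sP j) x by rewrite -ij; apply/sP_unrel; rewrite dx.
by move/sP_unrel; rewrite dx => /eqP.
Qed.

(** Two points of one [b]-fibre, one with bit [k] alone switched on and one with no bit on, are
    separated by [sE j] but not by [sE k.+1]. *)
Lemma sE_neq j k : j <= k -> sE k.+1 <> sE j.
Proof.
move=> jk e; have [x bx dx] := bd_surj u0 (finsupp_eq k).
have [|y bY dy] := @bd_surj u0 (fun _ => false); first by exists 0.
have : binrel A (sE j) x y.
  rewrite -e; apply/sE_binrel; split=> [|i ki]; first by rewrite bx.
  by rewrite dx dy; apply/eqP => ik; rewrite ik ltnn in ki.
by move/sE_binrel => [_ /(_ k jk)]; rewrite dx dy eqxx.
Qed.

Lemma sP_neq_sE i j : sP i <> sE j.
Proof. by move=> e; have := sP_arity i; rewrite e sE_arity. Qed.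

(** [uphalf] and [half] increase at alternate steps, so a predicate and an equivalence relation are
    added in turn, the predicate first. *)
Definition chain (n : nat) : set L :=
  [set s | (exists2 i, i < uphalf n & s = sP i) \/
           (exists2 j, j <= n./2 & s = sE j)].

Lemma chain_even k : chain k.*2 =
  [set s | (exists2 i, i < k & s = sP i) \/ (exists2 j, j <= k & s = sE j)].
Proof. by rewrite /chain uphalf_double doubleK. Qed.

Lemma chain_odd k : chain k.*2.+1 =
  [set s | (exists2 i, i <= k & s = sP i) \/ (exists2 j, j <= k & s = sE j)].
Proof. by rewrite /chain /= doubleK uphalf_double. Qed.

Lemma chain_proper n : chain n `<` chain n.+1.
Proof.
have [k [] ->] : exists k, n = k.*2 \/ n = k.*2.+1.
  exists n./2; rewrite -{1 3}(odd_double_half n).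
  by case: (odd n); [right|left].
- rewrite chain_odd chain_even; split=> [s [[i ik ->]|?]|/(_ (sP k))].
  + by left; exists i => //; exact: ltnW.
  + by right.
  + case=> [|[i ik /sP_inj e]|[j _ /sP_neq_sE //]]; first by left; exists k.
    by rewrite e ltnn in ik.
- rewrite -doubleS chain_odd chain_even; split=> [s [?|[j jk ->]]|/(_ (sE k.+1))].
  + by left.
  + by right; exists j => //; exact: leqW.
  + case=> [|[i _ /esym/sP_neq_sE //]|[j jk /(sE_neq jk) //]].
    by right; exists k.+1.
Qed.

Lemma chain_countable n : countable (chain n).
Proof.
apply: (@countable_cover (nat + nat) L
  (fun x => match x with inl i => sP i | inr j => sE j end) setT) => //.
by move=> s [[i _ ->]|[j _ ->]]; [exists (inl i)|exists (inr j)].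
Qed.

Lemma chain_index n (s : subsignature (chain n)) : exists i,
  (i < uphalf n /\ val s = sP i) \/ (i <= n./2 /\ val s = sE i).
Proof.
by have [[i ? ?]|[i ? ?]] := set_mem (valP s); exists i; [left|right].
Qed.

Lemma chain_binary n : binary_signature (subsignature (chain n)).
Proof.
move=> s; have [i [[_ sv]|[_ sv]]] := chain_index s; [left|right];
by rewrite arity_val sv (sP_arity, sE_arity).
Qed.

Section Index.
Variables (n : nat) (idx : subsignature (chain n) -> nat).
Hypothesis idxP : forall s,
  (idx s < uphalf n /\ val s = sP (idx s)) \/ (idx s <= n./2 /\ val s = sE (idx s)).

Lemma idx_un (s : subsignature (chain n)) :
  arity s = 1 -> idx s < uphalf n /\ val s = sP (idx s).
Proof.
by case: (idxP s) => // -[_ sv]; rewrite arity_val sv sE_arity.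
Qed.

Lemma idx_bin (s : subsignature (chain n)) :
  arity s = 2 -> idx s <= n./2 /\ val s = sE (idx s).
Proof.
by case: (idxP s) => // -[_ sv]; rewrite arity_val sv sP_arity.
Qed.

Lemma unrel_val (s : subsignature (chain n)) (i : nat) x :
  val s = sP i -> unrel (restriction A (chain n)) s x <-> d x i.
Proof.
by move=> sv; change (unrel A (val s) x <-> d x i); rewrite sv; exact: sP_unrel.
Qed.

Lemma binrel_val (s : subsignature (chain n)) (j : nat) x y :
  val s = sE j ->
  binrel (restriction A (chain n)) s x y <-> same_tail b d j x y.
Proof.
move=> sv; change (binrel A (val s) x y <-> same_tail b d j x y).
by rewrite sv; exact: sE_binrel.
Qed.

End Index.

(** The last predicate reads bit [k], which is constant on the classes of the finest relation named
    so far that ignores the bits below [k]; it is thus a free colour. *)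
Lemma chain_odd_not_cat k : ~ P_omega1_cat A (chain k.*2.+1).
Proof.
move=> [_ _]; have /choice[idx idxP] := @chain_index k.*2.+1.
have k_in : chain k.*2.+1 (sP k) by rewrite chain_odd; left; exists k.
pose s0 : subsignature (chain k.*2.+1) := exist _ (sP k) (mem_set k_in).
have s01 : arity s0 = 1 by exact: sP_arity.
have half : (k.*2.+1)./2 = k by rewrite /= uphalf_double.
have uhalf : uphalf k.*2.+1 = k.+1 by rewrite /= doubleK.
apply: (@free_colour_not_categorical _ U I _ b d u0 k idx s0) => //.
- by move=> s; case: (idxP s) => -[]; rewrite ?half ?uhalf.
- by move=> s /(idx_un idxP) [_ /unrel_val].
- by move=> s /(idx_bin idxP) [_ /binrel_val].
- exact: chain_binary.
- by have [_ /sP_inj] := idx_un idxP s01.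
Qed.

Lemma chain_even_cat k : P_omega1_cat A (chain k.*2).
Proof.
split=> //; first exact: chain_countable.
have /choice[idx idxP] := @chain_index k.*2.
have k_in : chain k.*2 (sE k) by rewrite chain_even; right; exists k.
pose tE : subsignature (chain k.*2) := exist _ (sE k) (mem_set k_in).
(* For indices from [k] on, [tE] is a dummy value. *)
have /choice[tP tPE] : forall i, exists t : subsignature (chain k.*2),
    i < k -> val t = sP i.
  move=> i; have [ik|_] := ltnP i k; last by exists tE.
  have i_in : chain k.*2 (sP i) by rewrite chain_even; left; exists i.
  by exists (exist _ (sP i) (mem_set i_in)).
have unP i x : i < k -> unrel (restriction A (chain k.*2)) (tP i) x <-> d x i.
  by move=> ik; apply: unrel_val; exact: tPE.
have binE x y : binrel (restriction A (chain k.*2)) tE x y <->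
    same_tail b d k x y by exact: binrel_val.
have half : (k.*2)./2 = k by rewrite doubleK.
have uhalf : uphalf k.*2 = k by rewrite uphalf_double.
have bits x y i : i < k ->
    (unrel (restriction A (chain k.*2)) (tP i) x <->
     unrel (restriction A (chain k.*2)) (tP i) y) <-> d x i = d y i.
  move=> ik; rewrite !unP //; split=> [h|->] //.
  by apply/idP/idP => /h.
apply: (@bit_model_categorical _ k idx tE tP) => //.
- exact: sE_arity.
- by move=> i ik; rewrite arity_val tPE // sP_arity.
- by move=> s /(idx_un idxP) []; rewrite uhalf.
- exact: chain_binary.
- by apply: countable_subsignature; exact: chain_countable.
split; first split.
- by move=> x; apply/binE.
- by move=> x y /binE h; apply/binE; exact: tail_sym.
- by move=> x y z /binE h /binE h'; apply/binE; exact: tail_trans h'.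
- move=> x y /binE h h'; apply: (tail_inj bd_inj h) => i ik.
  by apply/bits => //; exact: h'.
- move=> x f; have [y [yx dy]] := tail_fill k d_fin bd_surj x f.
  exists y; split=> [|i ik]; first by apply/binE; exact: tail_sym.
  by rewrite unP // dy.
- move=> s x /(idx_un idxP)[]; rewrite uhalf => ik sv.
  by rewrite unP // (unrel_val _ sv).
- move=> s x y /(idx_bin idxP)[]; rewrite half => jk sv.
  rewrite (binrel_val _ _ sv) (tail_le b d x y jk) binE.
  split=> -[h h']; split=> // i.
    by move=> /andP[ji ik]; apply/bits => //; exact: h'.
  by move=> ji ik; apply/bits => //; apply: h'; rewrite ji.
Qed.

End Chain.

Lemma alternating_chain (L : signature) (U : Type) (A : structure_on L U) :
  (forall r, exists s, interp A s = r) -> infinite_set [set: U] ->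
  exists N : nat -> set L, (forall n, N n `<` N n.+1) /\
    forall n, P_omega1_cat A (N n) <-> ~~ odd n.
Proof.
move=> allA infU; have [u0 _] := infinite_setN0 infU.
have [I [b [d [d_fin bd_inj bd_surj]]]] := bits_exist infU.
have /choice[sP sPE] := fun i => allA (existT (fun n => set (n.-tuple U)) 1
  [set t | exists2 x, val t = [:: x] & d x i]).
have /choice[sE sEE] := fun j => allA (existT (fun n => set (n.-tuple U)) 2
  [set t | exists x y, val t = [:: x; y] /\ same_tail b d j x y]).
exists (chain sP sE); split; first exact: (chain_proper u0 bd_surj sPE sEE).
move=> n; rewrite -(odd_double_half n) oddD odd_double addbF.
case: (odd n) => /=; split=> //.
  by move/(chain_odd_not_cat u0 d_fin bd_inj bd_surj sPE sEE).
by move=> _; exact: (chain_even_cat infU d_fin bd_inj bd_surj sPE sEE).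
Qed.

Theorem theorem8p3 (U : Type) (L : signature) (M : structure_on L U)
    (Lbar : signature) (Mbar : structure_on Lbar U)
    (regM : regular M) (infU : infinite_set [set: U])
    (maxM : maximal_regular_expansion M Mbar) :
  P_omega1_cat Mbar set0 /\
  closed_under_permutations Mbar (P_omega1_cat Mbar) /\
  (exists N K : set Lbar,
     [/\ P_omega1_cat Mbar N, K `<=` N & ~ P_omega1_cat Mbar K]) /\
  (exists N K : set Lbar,
     [/\ P_omega1_cat Mbar N, N `<=` K & ~ P_omega1_cat Mbar K]) /\
  (exists N : nat -> set Lbar,
     (forall n, N n `<` N n.+1) /\
     (forall n, P_omega1_cat Mbar (N n) <-> ~ P_omega1_cat Mbar (N n.+1))) /\
  (exists N : set Lbar,
     finite_set N /\ up_set N `&` P_omega1_cat Mbar = set0).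
Proof.
have [regA _ uniqA] := maxM.
have allA r : exists s, interp Mbar s = r by have [s [sr _]] := uniqA r; exists s.
have [N [Nprop Ncat]] := alternating_chain allA infU.
split; first exact: restriction_set0_categorical.
split; first exact: P_omega1_cat_perm.
have nN1 : ~ P_omega1_cat Mbar (N 1) by rewrite Ncat.
split.
  (* The first odd member serves twice: as a restriction of [N 2] here, and as an expansion of [N 0]
     below. *)
  by exists (N 2), (N 1); split=> //; [exact/Ncat|exact: (Nprop 1).1].
split.
  by exists (N 0), (N 1); split=> //; [exact/Ncat|exact: (Nprop 0).1].
split; last exact: omega_order_up_set.
by exists N; split=> // n; rewrite !Ncat /= negbK; split=> /negP.
Qed.
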